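(* Let $n\ge4$, let $\check{\mathcal Q}_{D_n}=\{\mathbf x\in\mathbb Z^n:\sum x_i\equiv0\bmod2\}$ be the type $D_n$ coroot lattice, and let $\iota:\check{\mathcal Q}_{D_n}\to\check{\mathcal Q}_{2n}$, $\iota(x_1,\dots,x_n)=(x_1,\dots,x_n,-x_n,\dots,-x_1)$. The map $\mathbf x\mapsto\lambda_{\iota(\mathbf x)}$ is a $\widetilde W(D_n)$-equivariant bijection between $\check{\mathcal Q}_{D_n}$ and the set of self-conjugate $2n$-cores with an even number of boxes on the main diagonal. For $\mathbf x\in\check{\mathcal Q}_{D_n}$, writing $\lambda=\lambda_{\iota(\mathbf x)}$, $$\check{\mathrm{size}}_i(\mathbf x)=\frac12\begin{cases}\mathrm{size}_i(\lambda)+\mathrm{size}_{2n-i}(\lambda)&\text{if }1<i<n-1,\\ \mathrm{size}_{n-1}(\lambda)+\mathrm{size}_{n+1}(\lambda)-\mathrm{size}_n(\lambda)&\text{if }i=n-1,\\ \mathrm{size}_1(\lambda)+\mathrm{size}_{2n-1}(\lambda)-\mathrm{size}_0(\lambda)&\text{if }i=1,\\ \mathrm{size}_i(\lambda)&\text{if }i=0,n,\end{cases}$$ and hence $\check{\mathrm{size}}(\mathbf x)=\frac12\big(\mathrm{size}(\lambda)-\mathrm{size}_0(\lambda)-\mathrm{size}_n(\lambda)\big)$.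
   Context: Partitions and cores. For $m\ge2$ an $m$-core is an integer partition with no hook of length $m$. Let $\check{\mathcal Q}_m=\{q\in\mathbb Z^m:\sum q_j=0\}$. For $q\in\check{\mathcal Q}_m$, define a bi-infinite word with positions $p\in\mathbb Z$: write $p=m(\ell-1)+j$ with $\ell\in\mathbb Z$, $1\le j\le m$, and put $\bullet$ at position $p$ if $\ell\le q_j$, and $\circ$ otherwise. Reading the word in increasing $p$ with $\bullet$ an up-step and $\circ$ a right-step traces, from bottom left to top right, the boundary of a unique partition (English notation); this is $\lambda_q$. (Its parts are the nonzero numbers $\#\{p'<p:\ p'\text{ is }\circ\}$ over positions $p$ carrying $\bullet$.) The map $q\mapsto\lambda_q$ is a bijection from $\check{\mathcal Q}_m$ to $m$-cores. The content of the box in row $u$, column $v$ is $v-u$; $\mathrm{size}_i(\lambda)$ is the number of boxes of $\lambda$ with content $\equiv i$ mod $m$ (here $m=2n$), and $\mathrm{size}(\lambda)$ is the total number of boxes. The affine symmetric group $\widetilde{\mathfrak S}_m$ acts on $\check{\mathcal Q}_m$: $s_i^A$ ($1\le i<m$) swaps coordinates $i,i+1$, and $s_0^A(q_1,\dots,q_m)=(q_m+1,q_2,\dots,q_{m-1},q_1-1)$. It acts on $m$-cores by letting $s_i^A$ add all addable boxes of content $i$ mod $m$, or remove all removable boxes of content $i$ mod $m$. Type $D_n$. Simple roots $\alpha_i=e_i-e_{i+1}$ for $1\le i<n$, $\alpha_n=e_{n-1}+e_n$ in $\mathbb R^n$ with the standard inner product. The affine Weyl group $\widetilde W(D_n)$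 acts on $\check{\mathcal Q}_{D_n}$ by: $s_i$ swaps $x_i,x_{i+1}$ for $1\le i<n$; $s_n(x_1,\dots,x_{n-1},x_n)=(x_1,\dots,x_{n-2},-x_n,-x_{n-1})$; $s_0(x_1,x_2,x_3,\dots,x_n)=(1-x_2,1-x_1,x_3,\dots,x_n)$. On the self-conjugate $2n$-cores with an even number of diagonal boxes it acts by $s_i\mapsto s_i^As_{2n-i}^A$ for $1\le i<n$, $s_n\mapsto s_n^As_{n-1}^As_{n+1}^As_n^A$, $s_0\mapsto s_0^As_1^As_{2n-1}^As_0^A$. Define $\check{\mathrm{size}}_i(\mathbf x)=\langle\frac{c_i}2\mathbf x-\check\omega_i,\mathbf x\rangle$ for $0\le i\le n$ and $\check{\mathrm{size}}=\sum_{i=0}^n\check{\mathrm{size}}_i$, where $\check\omega_0=0$, $\check\omega_1,\dots,\check\omega_n$ is the basis dual to the simple roots (so $\check\omega_i=e_1+\dots+e_i$ for $i\le n-2$, $\check\omega_{n-1}=\frac12(e_1+\dots+e_{n-1}-e_n)$, $\check\omega_n=\frac12(e_1+\dots+e_n)$), $c_0=1$, and $c_i$ are the coefficients of the highest root $e_1+e_2$ in simple roots ($c_1=c_{n-1}=c_n=1$, $c_i=2$ for $2\le i\le n-2$). *)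

(* Defs.v *)
From mathcomp Require Import all_boot all_order all_algebra.
From mathcomp Require Import classical_sets functions.
From mathcomp Require Import zify lra.

Set Implicit Arguments.
Unset Strict Implicit.
Unset Printing Implicit Defensive.

Import Order.TTheory GRing.Theory Num.Theory.

Local Open Scope ring_scope.

(* A partition is the weakly decreasing list of its nonzero parts.  Boxes are
   pairs (row, column) numbered from 0, so contents agree with the 1-based
   convention. *)
Definition is_part (la : seq nat) : bool := sorted geq la && (0%N \notin la).

Definition boxes (la : seq nat) : seq (nat * nat) :=
  [seq (u, v) | u <- iota 0 (size la), v <- iota 0 (nth 0%N la u)].

Definition content (b : nat * nat) : int := b.2%:Z - b.1%:Z.

Definition has_residue (m i : nat) (b : nat * nat) : bool :=
  (content b == i%:Z %[mod m%:Z])%Z.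

Definition psize (la : seq nat) : nat := size (boxes la).

Definition psize_res (m i : nat) (la : seq nat) : nat :=
  count (has_residue m i) (boxes la).

Definition ndiag (la : seq nat) : nat := count (fun b => b.1 == b.2) (boxes la).

Definition conjp (la : seq nat) : seq nat :=
  [seq count (fun r => (v < r)%N) la | v <- iota 0 (head 0%N la)].

Definition hook (la : seq nat) (b : nat * nat) : nat :=
  ((nth 0 la b.1 - b.2.+1) + (nth 0 (conjp la) b.2 - b.1.+1) + 1)%N.

Definition is_core (m : nat) (la : seq nat) : bool :=
  is_part la && all (fun b => hook la b != m) (boxes la).

(* The only box of row u that can be added is (u, la_u), and the only one that
   can be removed is (u, la_u - 1). *)
Definition addable (m i : nat) (la : seq nat) (u : nat) : bool :=
  ((u == 0) || (nth 0 la u < nth 0 la u.-1))%N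
  && has_residue m i (u, nth 0%N la u).

Definition removable (m i : nat) (la : seq nat) (u : nat) : bool :=
  (nth 0 la u.+1 < nth 0 la u)%N && has_residue m i (u, (nth 0%N la u).-1).

(* On an m-core, addable and removable boxes of the same residue do not
   coexist. *)
Definition sA (m i : nat) (la : seq nat) : seq nat :=
  let rows := iota 0 (size la).+1 in
  [seq r <- if has (addable m i la) rows
            then [seq (nth 0 la u + addable m i la u)%N | u <- rows]
            else [seq (nth 0 la u - removable m i la u)%N | u <- rows]
   | (0 < r)%N].

Definition corootA (m : nat) : set 'rV[int]_m :=
  [set q | (\sum_j q 0 j = 0)%R]%classic.

(* Indices j : 'I_m start at 0 whereas coordinates start at 1: a position
   p = m (l - 1) + (j + 1) carries a bullet iff l <= q_(j+1). *)
Definition bullet (m : nat) (q : 'rV[int]_m) (p : int) : bool :=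
  [exists j : 'I_m, (m%:Z %| p - j.+1%:Z)%Z
                    && (((p - j.+1%:Z) %/ m%:Z)%Z + 1 <= q 0 j)].

Definition word_bound (m : nat) (q : 'rV[int]_m) : nat :=
  (\sum_j `|(q 0 j)%R|)%N.

(* The positions p with - m N < p <= m N, where N = word_bound q, in decreasing
   order; by [bullet_low] and [bullet_high] below, the word is constant on
   either side. *)
Definition positions (m : nat) (q : 'rV[int]_m) : seq int :=
  let M := (m * word_bound q)%N in [seq M%:Z - k%:Z | k <- iota 0 (M + M)].

Definition holes_before (m : nat) (q : 'rV[int]_m) (p : int) : nat :=
  count (fun p' => (p' < p) && ~~ bullet q p') (positions q).

Definition lambda (m : nat) (q : 'rV[int]_m) : seq nat :=
  [seq r <- [seq holes_before q p | p <- positions q & bullet q p] | (0 < r)%N].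

Lemma word_bound_ge (m : nat) (q : 'rV[int]_m) (j : 'I_m) :
  - (word_bound q)%:Z <= q 0 j <= (word_bound q)%:Z.
Proof.
have : (`|(q 0 j)%R| <= word_bound q)%N by rewrite /word_bound (bigD1 j) ?leq_addr.
lia.
Qed.

Lemma bullet_low (m : nat) (q : 'rV[int]_m) (p : int) :
  (0 < m)%N -> p <= - (m * word_bound q)%N%:Z -> bullet q p.
Proof.
move=> m0 hp.
have mZ : m%:Z != 0 by lia.
have hr0 := modz_ge0 (p - 1) mZ.
have hrm : ((p - 1) %% m%:Z)%Z < m%:Z by apply: ltz_pmod; lia.
have hE := divz_eq (p - 1) m%:Z.
set r := ((p - 1) %% m%:Z)%Z in hr0 hrm hE.
set d := ((p - 1) %/ m%:Z)%Z in hE.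
have hj : (`|r| < m)%N by lia.
have E : p - `|r|.+1%:Z = d * m%:Z by lia.
apply/existsP; exists (Ordinal hj); rewrite /= E dvdz_mull //= mulzK //.
have /andP[lo _] := word_bound_ge q (Ordinal hj).
apply: le_trans lo; rewrite PoszM in hp.
nia.
Qed.

Lemma bullet_high (m : nat) (q : 'rV[int]_m) (p : int) :
  (m * word_bound q)%N%:Z < p -> ~~ bullet q p.
Proof.
move=> hp; apply/existsP => -[j /andP[/dvdzP[d E]]].
have m0 : m%:Z != 0 by have := ltn_ord j; lia.
rewrite E mulzK // => le_d.
have /andP[_ hi] := word_bound_ge q j.
have hj := ltn_ord j.
rewrite PoszM in hp; nia.
Qed.

Definition corootD (n : nat) : set 'rV[int]_n :=
  [set x : 'rV[int]_n | (2%:Z %| (\sum_j x 0 j)%R)%Z]%classic.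

Definition iotaQ (n : nat) (x : 'rV[int]_n) : 'rV[int]_(n + n) :=
  row_mx x (\row_(j < n) - x 0 (rev_ord j)).

Lemma iotaQ_corootA (n : nat) (x : 'rV[int]_n) : corootA (iotaQ x).
Proof.
rewrite /corootA /= big_split_ord /=.
under eq_bigr do rewrite row_mxEl.
under [X in _ + X]eq_bigr do rewrite row_mxEr mxE.
by rewrite sumrN [X in _ - X](reindex_inj rev_ord_inj) /=;
   under [X in _ - X]eq_bigr do rewrite rev_ordK; rewrite subrr.
Qed.

Definition even_sc_cores (n : nat) : set (seq nat) :=
  [set la | [&& is_core (n + n) la, conjp la == la & ~~ odd (ndiag la)]]%classic.

(* Coordinates in type D are numbered from 1 to n, as in [std_vec]. *)
Definition coordD (n : nat) (x : 'rV[int]_n) (k : nat) : int :=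
  \sum_(j < n | j.+1 == k) x 0 j.

Definition of_coordD (n : nat) (f : nat -> int) : 'rV[int]_n :=
  \row_(j < n) f j.+1.

Definition sD (n i : nat) (x : 'rV[int]_n) : 'rV[int]_n :=
  of_coordD n (fun k =>
    if i == 0%N then
      if k == 1%N then 1 - coordD x 2
      else if k == 2%N then 1 - coordD x 1
      else coordD x k
    else if i == n then
      if k == n.-1 then - coordD x n
      else if k == n then - coordD x n.-1
      else coordD x k
    else
      if k == i then coordD x i.+1
      else if k == i.+1 then coordD x i
      else coordD x k).

Definition sD_core (n i : nat) (la : seq nat) : seq nat :=
  let s := sA (n + n) in
  if i == 0%N then s 0%N (s 1%N (s (n + n).-1 (s 0%N la)))
  else if i == n then s n (s n.-1 (s n.+1 (s n la)))
  else s i (s (n + n - i)%N la).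

(* Elements of the affine Weyl group are written as words in its generators,
   numbered 0, ..., n, which are involutions. *)
Definition word_act (n : nat) (T : Type) (s : nat -> T -> T)
    (w : seq 'I_n.+1) (t : T) : T :=
  foldr (fun i : 'I_n.+1 => s i) t w.

(* Two words are the same group element iff they define the same affine
   transformation of R^n, which can be tested on Z^n. *)
Definition same_element (n : nat) (w w' : seq 'I_n.+1) : Prop :=
  forall x : 'rV[int]_n, word_act (@sD n) w x = word_act (@sD n) w' x.

Definition WD_acts (n : nat) (T : Type) (S : set T) (s : nat -> T -> T) : Prop :=
  (forall (w : seq 'I_n.+1) t, S t -> S (word_act s w t)) /\
  (forall w w' : seq 'I_n.+1, same_element w w' ->
     forall t, S t -> word_act s w t = word_act s w' t).

Definition WD_equivariant (n : nat) (T U : Type) (S : set T)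
    (s : nat -> T -> T) (s' : nat -> U -> U) (f : T -> U) : Prop :=
  forall (w : seq 'I_n.+1) t, S t -> f (word_act s w t) = word_act s' w (f t).

Definition dot (n : nat) (u v : 'rV[rat]_n) : rat := \sum_j u 0 j * v 0 j.

Definition std_vec (n k : nat) : 'rV[rat]_n := \row_(j < n) (j.+1 == k)%:R.

Definition simple_root (n i : nat) : 'rV[rat]_n :=
  if (i < n)%N then std_vec n i - std_vec n i.+1 else std_vec n n.-1 + std_vec n n.

(* This is the basis dual to the simple roots: see [coweight_dual]. *)
Definition coweight (n i : nat) : 'rV[rat]_n :=
  if i == 0%N then 0
  else if (i <= n - 2)%N then \sum_(1 <= k < i.+1) std_vec n k
  else if i == n.-1 then 2^-1 *: (\sum_(1 <= k < n) std_vec n k - std_vec n n)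
  else 2^-1 *: \sum_(1 <= k < n.+1) std_vec n k.

(* The coefficients of the highest root, with value 1 at 0: see
   [highest_root_mark]. *)
Definition mark (n i : nat) : nat := if (2 <= i <= n - 2)%N then 2 else 1.

Lemma dot_std_vec (n k l : nat) :
  (0 < k <= n)%N -> dot (std_vec n k) (std_vec n l) = (k == l)%:R.
Proof.
move=> hk; have hk' : (k.-1 < n)%N by lia.
rewrite /dot (bigD1 (Ordinal hk')) //= big1 => [|j jk]; last first.
  rewrite !mxE; have -> : (j.+1 == k) = false; last by rewrite mul0r.
  by apply/negbTE; apply: contra jk => /eqP E; apply/eqP/val_inj => /=; lia.
have E : k.-1.+1 = k by lia.
by rewrite !mxE /= E eqxx mul1r addr0.
Qed.

Lemma dotDl n (u v w : 'rV[rat]_n) : dot (u + v) w = dot u w + dot v w.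
Proof. by rewrite -big_split; apply: eq_bigr => j _; rewrite mxE mulrDl. Qed.

Lemma dotDr n (u v w : 'rV[rat]_n) : dot w (u + v) = dot w u + dot w v.
Proof. by rewrite -big_split; apply: eq_bigr => j _; rewrite mxE mulrDr. Qed.

Lemma dotNl n (u w : 'rV[rat]_n) : dot (- u) w = - dot u w.
Proof. by rewrite -sumrN; apply: eq_bigr => j _; rewrite mxE mulNr. Qed.

Lemma dotZr n a (u w : 'rV[rat]_n) : dot w (a *: u) = a * dot w u.
Proof. by rewrite mulr_sumr; apply: eq_bigr => j _; rewrite mxE mulrCA. Qed.

Lemma dot_std_vec_sum (n k i : nat) : (0 < k <= n)%N ->
  dot (std_vec n k) (\sum_(1 <= l < i.+1) std_vec n l) = (k <= i)%:R.
Proof.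
move=> hk; elim: i => [|i IH].
  rewrite big_geq // /dot big1 => [|j _]; last by rewrite !mxE mulr0.
  by have -> : (k <= 0)%N = false by lia.
rewrite big_nat_recr //= dotDr IH dot_std_vec // -natrD; congr _%:R.
lia.
Qed.

Lemma coweight_dual (n i j : nat) :
  (4 <= n)%N -> (0 < i <= n)%N -> (0 < j <= n)%N ->
  dot (simple_root n i) (coweight n j) = (i == j)%:R.
Proof.
move=> hn hi hj.
have dN w k : dot w (- std_vec n k) = - dot w (std_vec n k).
  by rewrite -scaleN1r dotZr mulN1r.
have E : \sum_(1 <= k < n) std_vec n k = \sum_(1 <= k < n.-1.+1) std_vec n k.
  by congr bigop; congr index_iota; lia.
rewrite /simple_root /coweight E.
have -> : (j == 0%N) = false by lia.
case: ltnP => hin; case: (leqP j (n - 2)) => hj2; last 1 first.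
- have hin' : i = n by lia.
  subst i; case: eqP => [->|hjn];
  rewrite ?(dotZr, dotDr, dotDl, dotNl, dN) ?dot_std_vec_sum ?dot_std_vec; try lia.
  + have -> : (n.-1 <= n.-1)%N by lia.
    have -> : (n <= n.-1)%N = false by lia.
    have -> : (n.-1 == n) = false by lia.
    have -> : (n == n.-1) = false by lia.
    by rewrite eqxx subr0 sub0r mulrN subrr.
  + have -> : j = n by lia.
    have -> : (n.-1 <= n)%N by lia.
    by rewrite leqnn eqxx -mulrDr mulVf.
- rewrite dotDl dotNl !dot_std_vec_sum; try lia.
  by case: ltngtP; rewrite ?subrr ?subr0.
- case: eqP => [hjn|hjn];
  rewrite ?(dotZr, dotDr, dotDl, dotNl, dN) ?dot_std_vec_sum ?dot_std_vec; try lia.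
  + have -> : (i <= n.-1)%N by lia.
    have -> : (i == n) = false by lia.
    case: (eqVneq i j) => hij.
      have -> : (i.+1 <= n.-1)%N = false by lia.
      by have -> : (i.+1 == n) by lia.
    have -> : (i.+1 <= n.-1)%N by lia.
    by have -> : (i.+1 == n) = false by lia.
  + have -> : (i <= n)%N by lia.
    have -> : (i.+1 <= n)%N by lia.
    have -> : (i == j) = false by lia.
    by [].
- have hin' : i = n by lia.
  subst i; rewrite dotDl !dot_std_vec_sum; try lia.
  have -> : (n.-1 <= j)%N = false by lia.
  have -> : (n <= j)%N = false by lia.
  by have -> : (n == j) = false by lia.
Qed.

Lemma highest_root_mark (n : nat) : (4 <= n)%N ->
  \sum_(1 <= i < n.+1) (mark n i)%:R *: simple_root n i = std_vec n 1 + std_vec n 2.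
Proof.
move=> hn.
have P k : (k < n - 2)%N ->
    \sum_(1 <= i < k.+2) (mark n i)%:R *: simple_root n i
    = std_vec n 1 + (k != 0%N)%:R *: std_vec n 2 - (k != 0%N).+1%:R *: std_vec n k.+2.
  elim: k => [|k IH] hk.
    rewrite big_nat1 /mark /simple_root /=; have -> : (1 < n)%N by lia.
    by rewrite scale0r addr0 !scale1r.
  rewrite big_nat_recr //= IH; last lia.
  rewrite /mark /simple_root; have -> : (1 < k.+2 <= n - 2)%N by lia.
  have -> : (k.+2 < n)%N by lia.
  by case: k {IH hk} => [|k] /=; apply/rowP => j; rewrite !mxE; lra.
have E : n.+1 = (n - 3).+4 by lia.
rewrite {1}E 2?big_nat_recr //= P; last lia.
rewrite /mark /simple_root.
have -> : (n - 3).+3 = n by lia.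
have -> : (n - 3).+2 = n.-1 by lia.
have -> : (1 < n.-1 <= n - 2)%N = false by lia.
have -> : (1 < n <= n - 2)%N = false by lia.
have -> : (n - 3 != 0)%N by lia.
have -> : (n < n)%N = false by lia.
have -> : (n <= n)%N by lia.
by apply/rowP => j; rewrite !mxE /=; lra.
Qed.

Definition sizeD_res (n i : nat) (x : 'rV[int]_n) : rat :=
  let y : 'rV[rat]_n := map_mx intr x in
  dot (((mark n i)%:R / 2) *: y - coweight n i) y.

Definition sizeD (n : nat) (x : 'rV[int]_n) : rat :=
  \sum_(i < n.+1) sizeD_res i x.

(* Main.v *)
Require Import Defs.
From mathcomp Require Import all_boot all_order all_algebra.
From mathcomp Require Import classical_sets functions.
From mathcomp Require Import zify ring lra.

(** A partition is determined by its Maya diagram, the set of its beads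
    [la_u - u]; every statement is proved on that side.

    On Maya diagrams all the structure becomes elementary.  The other
    positions, the holes, are the numbers [v + 1 - la'_v], and the hook length
    of the box [(u, v)] is the difference between the [u]-th bead and the
    [v]-th hole.  Hence [la] is an [m]-core iff its beads are stable under
    [p |-> p - m] ([core_maya]), and conjugation is the reflection
    [p |-> 1 - p] composed with the complement ([maya_conjp]).  On a core, the
    [i]-th generator exchanges the positions congruent to [i] and [i + 1]
    modulo [m] ([maya_sA]).

    The word of [q] is the Maya diagram of [lambda q] as soon as the
    coordinates of [q] add up to [0]: this balance makes the number of holes
    before the [u]-th bullet [p] equal to [p + u] ([lambda_bullets]).
    Conversely the beads of a core fill each residue class up to some level,
    and these levels form a vector [q] ([core_lambda]).

    To compare the actions, the coordinates of [q] are extended to all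
    positions by [q_(p + m) = q_p - 1] ([qext]), so that [p] carries a bullet iff
    [q_p] is positive.  A generator of type A then acts by composition with an
    exchange of positions, and the image of [iotaQ] is cut out by the symmetry
    [q_(1 - p) = 1 - q_p].  Since this symmetry and the periodicity are
    preserved, equivariance has to be verified only at the positions
    [1, ..., n], where it is a finite computation ([qext_sD]).  The symmetry
    also identifies the image of [iotaQ] with the self-conjugate cores, and the
    number of diagonal boxes, which counts the positive bullets, is
    [\sum_j `|x_j|], of the parity of [\sum_j x_j] ([even_ndiag]).
    The relations of the affine Weyl group on cores are transported along the
    bijection.

    For the sizes, a count of boxes that depends only on the content has a
    discrete primitive [F], and row [u] contributes [F (la_u - u) - F (- u)].
    Summing over the beads class by class ([count_lambda]) with
    [F p = floor ((p - 1 - i) / m)] gives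
    [size_i (lambda q) = |q|^2 / 2 - (q_1 + ... + q_i)], which is compared with
    the explicit value of [sizeD_res]. *)

Set Implicit Arguments.
Unset Strict Implicit.
Unset Printing Implicit Defensive.

Import Order.TTheory GRing.Theory Num.Theory.

Local Open Scope ring_scope.

(** * Beads of a partition *)

Definition bead (la : seq nat) (u : nat) : int := (nth 0%N la u)%:Z - u%:Z.

(** The bound on the row index makes membership decidable: a bead of an empty
    row [u] sits at [- u]. *)
Definition maya (la : seq nat) (p : int) : bool :=
  has (fun u => bead la u == p) (iota 0 (size la + `|p|).+1).

Lemma mayaP la p : reflect (exists u, bead la u = p) (maya la p).
Proof.
apply: (iffP hasP) => [[u _ /eqP]|[u E]]; first by exists u.
exists u; last by rewrite E.
rewrite mem_iota; case: (ltnP u (size la)) => hu; first by lia.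
move: E; rewrite /bead nth_default //; lia.
Qed.

Lemma geq_trans : transitive geq.
Proof. by move=> b a c /= ba cb; apply: leq_trans ba. Qed.

Lemma nth_geq t u v : sorted geq t -> (u <= v)%N -> (nth 0 t v <= nth 0 t u)%N.
Proof.
move=> st uv; case: (ltnP v (size t)) => hv; last by rewrite nth_default.
apply: (sorted_leq_nth (leT := geq) geq_trans leqnn 0%N st) => //.
by apply: leq_ltn_trans hv.
Qed.

Lemma part_sorted la : is_part la -> sorted geq la.
Proof. by case/andP. Qed.

Lemma bead_lt la u v : is_part la -> (u < v)%N -> bead la v < bead la u.
Proof.
move=> /part_sorted hla uv; have := nth_geq hla (ltnW uv); rewrite /bead; lia.
Qed.

Lemma nth_part_gt0 la u : is_part la -> (u < size la)%N -> (0 < nth 0 la u)%N.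
Proof.
move=> /andP[_ h0] hu; rewrite lt0n; apply: contraNneq h0 => <-.
exact: mem_nth.
Qed.

Lemma part_ext la mu : is_part la -> is_part mu ->
  (forall u, nth 0%N la u = nth 0%N mu u) -> la = mu.
Proof.
move=> hla hmu E.
(* A longer list would have a nonzero part where the other has none. *)
have size_le a b : is_part a -> (forall u, nth 0%N a u = nth 0%N b u) ->
    (size a <= size b)%N.
  move=> ha Eab; rewrite leqNgt; apply/negP => /(nth_part_gt0 ha).
  by rewrite Eab nth_default.
apply: (@eq_from_nth _ 0%N) => [|u _]; last exact: E.
by apply/eqP; rewrite eqn_leq !size_le // => u; rewrite E.
Qed.

(** By strong induction on [u]: the [u]-th bead is the largest element of the
    diagram below the previous beads. *)
Lemma maya_inj la mu : is_part la -> is_part mu -> maya la =1 maya mu -> la = mu.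
Proof.
move=> hla hmu E; apply: part_ext => // u.
suff : bead la u = bead mu u by rewrite /bead; lia.
elim/ltn_ind: u => u IH.
have le a b : is_part a -> is_part b -> maya a =1 maya b ->
    (forall v, (v < u)%N -> bead a v = bead b v) -> bead a u <= bead b u.
  move=> ha hb Eab IHab.
  have /mayaP[v Ev] : maya b (bead a u) by rewrite -Eab; apply/mayaP; exists u.
  case: (ltngtP v u) => [vu|uv|vu]; last by rewrite -Ev vu.
  - by have := bead_lt ha vu; rewrite (IHab _ vu) Ev ltxx.
  - by rewrite -Ev ltW // bead_lt.
by apply/le_anti; rewrite !le // => v /IH.
Qed.

(** In a decreasing list the zeros come last, so that deleting them shifts no
    part. *)
Lemma nth_filter_gt0 t u : sorted geq t ->
  nth 0%N [seq r <- t | (0 < r)%N] u = nth 0%N t u.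
Proof.
elim: t u => [|a t IH] u //= pt.
have st := path_sorted pt.
case: a pt => [|a] pt /=; last by case: u => //= u; rewrite IH.
rewrite IH //; have h := @nth_geq (0%N :: t) 0 u pt isT.
by have := @nth_geq (0%N :: t) 0 u.+1 pt isT; move: h; rewrite /=; lia.
Qed.

Lemma part_filter_gt0 t : sorted geq t -> is_part [seq r <- t | (0 < r)%N].
Proof.
move=> st; rewrite /is_part sorted_filter ?mem_filter //; exact: geq_trans.
Qed.

(** * Holes, hooks and conjugation *)

Definition col (la : seq nat) (v : nat) : nat := count (fun r => (v < r)%N) la.

(** Position of the horizontal step of the boundary that closes column [v]. *)
Definition hole (la : seq nat) (v : nat) : int := v.+1%:Z - (col la v)%:Z.

(** Both sides say that [(u, v)] is a box. *)
Lemma ltn_nth_col la u v : sorted geq la -> (v < nth 0 la u)%N = (u < col la v)%N.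
Proof.
elim: la u => [|a la IH] u pla; first by rewrite nth_nil.
have sla := path_sorted (pla : path geq a la).
have col0 : (a <= v)%N -> col la v = 0%N.
  move=> av; apply/eqP; rewrite -leqn0 leqNgt -IH // -leqNgt.
  exact: leq_trans (@nth_geq (a :: la) 0 1 pla isT) av.
have -> : col (a :: la) v = ((v < a) + col la v)%N by [].
case: u => [|u] /=; first by case: ltnP => // /col0 ->.
by rewrite IH //; case: (ltnP v a) => [_|/col0 ->].
Qed.

(** The difference of the two positions is the hook length of [(u, v)] when
    [(u, v)] is a box, and is negative otherwise. *)
Lemma bead_neq_hole la u v : is_part la -> bead la u != hole la v.
Proof.
move=> /part_sorted hla; have := ltn_nth_col u v hla; rewrite /bead /hole.
case: ltnP; lia.
Qed.

(** Take the first row [u] whose bead is at most [p].  If its bead is not [p], the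
    column [p + u - 1] has exactly [u] boxes, and its hole is at [p]. *)
Lemma bead_or_hole la p : is_part la ->
  (exists u, bead la u = p) \/ (exists v, hole la v = p).
Proof.
move=> /part_sorted hla.
have exP : exists u, bead la u <= p.
  exists (size la + `|p|)%N; rewrite /bead nth_default; lia.
case: (ex_minnP exP) => u hu umin.
have [E|ne] := eqVneq (bead la u) p; first by left; exists u.
have lt_p : bead la u < p by rewrite lt_neqAle ne.
right; exists `|(p + u%:Z - 1)%R|%N; rewrite /hole.
set v := `|_|%N.
have Ev : v%:Z = p + u%:Z - 1 by rewrite /bead in lt_p; rewrite /v; lia.
suff : col la v = u by lia.
apply/eqP; rewrite eqn_leq leqNgt -ltn_nth_col //; apply/andP; split.
  rewrite /bead in lt_p; lia.
case: u {hu ne v} umin v Ev lt_p => // u umin v Ev lt_p.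
rewrite -ltn_nth_col //.
have := umin u; rewrite ltnn /bead; lia.
Qed.

Lemma mayaN la p : is_part la -> reflect (exists v, hole la v = p) (~~ maya la p).
Proof.
move=> hla; apply: (iffP idP) => [/mayaP np|[v <-]].
  by case: (bead_or_hole p hla).
by apply/mayaP => -[u /eqP]; apply/negP/bead_neq_hole.
Qed.

Lemma nth_conjp la v : is_part la -> nth 0%N (conjp la) v = col la v.
Proof.
move=> /part_sorted hla; rewrite /conjp.
case: (ltnP v (head 0%N la)) => hv.
  by rewrite (nth_map 0%N) ?size_iota // nth_iota.
rewrite nth_default ?size_map ?size_iota //; apply/esym/eqP.
by rewrite -leqn0 leqNgt -ltn_nth_col // -leqNgt nth0.
Qed.

Lemma col_geq la v w : (v <= w)%N -> (col la w <= col la v)%N.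
Proof. move=> vw; apply: sub_count => r /=; exact: leq_ltn_trans. Qed.

Lemma conjp_part la : is_part la -> is_part (conjp la).
Proof.
move=> hla; apply/andP; split.
  apply/(sortedP 0%N) => v; rewrite size_map size_iota => hv.
  by rewrite !nth_conjp //; apply: col_geq.
apply/negP => /(nthP 0%N)[v]; rewrite size_map size_iota => hv.
rewrite nth_conjp // => /eqP; apply/negP; rewrite -lt0n.
by rewrite -ltn_nth_col ?nth0 // part_sorted.
Qed.

Lemma maya_conjp la p : is_part la -> maya (conjp la) p = ~~ maya la (1 - p).
Proof.
move=> hla; apply/mayaP/(mayaN _ hla) => -[v E]; exists v; move: E;
  rewrite /bead /hole nth_conjp //; lia.
Qed.

Lemma mem_boxes la b : (b \in boxes la) = (b.2 < nth 0 la b.1)%N.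
Proof.
apply/allpairsPdep/idP => [[u [v []]]|hb].
  by rewrite !mem_iota /= !add0n => _ hv ->.
exists b.1, b.2; rewrite !mem_iota /= !add0n -surjective_pairing; split=> //.
by rewrite ltnNge; apply: contraTN hb => h; rewrite nth_default.
Qed.

Lemma hook_bead la b : is_part la -> b \in boxes la ->
  (hook la b)%:Z = bead la b.1 - hole la b.2.
Proof.
case: b => u v hla; rewrite mem_boxes => hb; have := hb.
rewrite ltn_nth_col ?part_sorted // /hook /bead /hole nth_conjp //.
by move: (nth _ _ _) (col _ _) hb => /= r c; lia.
Qed.

(** A hook of length [m] is a bead together with a hole [m] positions to the
    left. *)
Lemma core_maya m la : is_part la -> (0 < m)%N ->
  is_core m la <-> (forall p, maya la p -> maya la (p - m%:Z)).
Proof.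
move=> hla m0; rewrite /is_core hla /=; split=> [/allP hc p /mayaP[u <-]|hc].
  apply/negPn/negP => /(mayaN _ hla)[v Ev].
  have hb : (u, v) \in boxes la.
    rewrite mem_boxes /=; have := ltn_nth_col u v (part_sorted hla).
    move: Ev; rewrite /bead /hole; case: ltnP; lia.
  by have /eqP := hc _ hb; have := hook_bead hla hb; rewrite /= Ev; lia.
apply/allP => b hb; apply/eqP => E.
have := hook_bead hla hb; rewrite E => Em.
have : maya la (bead la b.1 - m%:Z) by apply: hc; apply/mayaP; exists b.1.
by apply/negP/(mayaN _ hla); exists b.2; lia.
Qed.

(** * Adding and removing boxes of a given residue *)

(** The permutation of the positions that the [i]-th generator of type A
    induces: a box of content [c] corresponds to a bead at [c + 1] that can move
    back to [c]. *)
Definition slide (m i : nat) (p : int) : int :=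
  if (p == i%:Z %[mod m%:Z])%Z then p + 1
  else if (p == i.+1%:Z %[mod m%:Z])%Z then p - 1 else p.

Lemma has_residue_bead m i la u :
  has_residue m i (u, nth 0%N la u) = (bead la u == i%:Z %[mod m%:Z])%Z.
Proof. by []. Qed.

Lemma eqz_modD1 (m p q : int) : (p + 1 == q + 1 %[mod m])%Z = (p == q %[mod m])%Z.
Proof. by rewrite !eqz_mod_dvd (_ : p + 1 - (q + 1) = p - q) //; ring. Qed.

Lemma neqz_modS (m : nat) (a : int) : (1 < m)%N -> (a == a + 1 %[mod m%:Z])%Z = false.
Proof.
move=> m1; rewrite eqz_mod_dvd; apply/negbTE.
by rewrite (_ : a - _ = -1) ?dvdzE /= ?dvdn1; lia.
Qed.

(** A box can be added to row [u] iff its bead can move one step to the right; the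
    box has the content of the old position. *)
Lemma addableE m i la u : is_part la ->
  addable m i la u = (bead la u == i%:Z %[mod m%:Z])%Z && ~~ maya la (bead la u + 1).
Proof.
move=> hla; rewrite /addable has_residue_bead andbC; congr (_ && _).
apply/idP/negP => [h /mayaP[v Ev]|h].
  case: (ltnP v u) => [vu|uv]; last first.
    have := nth_geq (part_sorted hla) uv; move: Ev; rewrite /bead; lia.
  case: u h vu Ev => // u /= h; rewrite ltnS => vu.
  have := nth_geq (part_sorted hla) vu; rewrite /bead; lia.
case: u h => //= u h; rewrite ltnNge; apply/negP => le; apply: h.
apply/mayaP; exists u; have := nth_geq (part_sorted hla) (leqnSn u).
rewrite /bead; lia.
Qed.

(** Mirror image of [addableE]; the box has the content of the new position. *)
Lemma removableE m i la u : is_part la ->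
  removable m i la u =
    (bead la u == i.+1%:Z %[mod m%:Z])%Z && ~~ maya la (bead la u - 1).
Proof.
move=> hla; rewrite /removable.
have -> : (nth 0 la u.+1 < nth 0 la u)%N = ~~ maya la (bead la u - 1).
  apply/idP/negP => [h /mayaP[v Ev]|h].
    case: (leqP v u) => [vu|uv].
      have := nth_geq (part_sorted hla) vu; move: Ev; rewrite /bead; lia.
    have := nth_geq (part_sorted hla) uv; move: Ev; rewrite /bead; lia.
  rewrite ltnNge; apply/negP => le; apply: h.
  apply/mayaP; exists u.+1; have := nth_geq (part_sorted hla) (leqnSn u).
  rewrite /bead; lia.
rewrite andbC; case hm: (maya _ _); rewrite ?andbF // !andbT.
have gt0 : (0 < nth 0 la u)%N.
  rewrite lt0n; apply: contraFneq hm => E; apply/mayaP; exists u.+1.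
  by have := nth_geq (part_sorted hla) (leqnSn u); rewrite /bead E; lia.
have -> : has_residue m i (u, (nth 0%N la u).-1) =
    ((bead la u - 1) == i%:Z %[mod m%:Z])%Z.
  rewrite /has_residue /content /bead /=; congr ((_ %% _)%Z == _); lia.
by rewrite -eqz_modD1 subrK -addn1 PoszD.
Qed.

Lemma slideK m i : (1 < m)%N -> involutive (slide m i).
Proof.
move=> m1 p; rewrite /slide.
have Ei : i.+1%:Z = i%:Z + 1 by lia.
rewrite Ei; case: (boolP (p == i%:Z %[mod _])%Z) => h.
  rewrite eqz_modD1 h; have -> : (p + 1 == i%:Z %[mod m%:Z])%Z = false.
    by rewrite -(eqP h) eq_sym neqz_modS.
  by rewrite addrK.
case: (boolP (p == i%:Z + 1 %[mod _])%Z) => h'; last by rewrite (negbTE h) (negbTE h').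
have -> : (p - 1 == i%:Z %[mod m%:Z])%Z by rewrite -eqz_modD1 subrK.
by rewrite subrK.
Qed.

Lemma slideD m i p k : slide m i (p + k * m%:Z) = slide m i p + k * m%:Z.
Proof.
rewrite /slide; have -> : (p + k * m%:Z = p %[mod m%:Z])%Z by rewrite addrC modzMDl.
by case: ifP => _; [ring | case: ifP => _; ring].
Qed.

(** The shape of both branches of [sA]. *)
Definition shift_rows (la : seq nat) (f : nat -> nat) :=
  [seq r <- [seq f u | u <- iota 0 (size la).+1] | (0 < r)%N].

Lemma shift_rowsP la f : (forall u, (f u.+1 <= f u)%N) ->
  (forall u, (size la < u)%N -> f u = 0%N) ->
  is_part (shift_rows la f) /\ forall u, nth 0%N (shift_rows la f) u = f u.
Proof.
move=> fS f0; set t := [seq f u | u <- iota 0 (size la).+1].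
have nt u : nth 0%N t u = f u.
  case: (leqP u (size la)) => hu.
    by rewrite (nth_map 0%N) ?size_iota // nth_iota.
  by rewrite nth_default ?f0 // size_map size_iota.
have st : sorted geq t.
  by apply/(sortedP 0%N) => u _; rewrite !nt; apply: fS.
by split=> [|u]; [exact: part_filter_gt0 | rewrite nth_filter_gt0].
Qed.

(** A bead that stays put occupies both ends of its exchange, so moving only
    the unblocked beads has the effect of the exchange on the whole diagram. *)
Lemma maya_moved la mu (s : int -> int) : involutive s ->
  (forall u, bead mu u =
    if maya la (s (bead la u)) then bead la u else s (bead la u)) ->
  forall p, maya mu p = maya la (s p).
Proof.
move=> sK bmu p; apply/mayaP/idP => [[u <-]|].
  by rewrite bmu; case: ifP => // _; rewrite sK; apply/mayaP; exists u.
move=> hsp; case: (boolP (maya la p)) => [/mayaP[v Ev]|hp].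
  by exists v; rewrite bmu Ev hsp.
have /mayaP[u Eu] := hsp; exists u.
by rewrite bmu Eu sK (negbTE hp).
Qed.

(** If a box can be added at the bead [a], then no box of the same residue can be
    removed at a bead [p]: since [a] and [p - 1] are congruent, stability under
    [p |-> p - m] yields a bead at [p - 1] if [p - 1 <= a], and a bead at [a + 1]
    otherwise.  Hence in both branches of [sA] the rows that change are those
    whose bead is unblocked. *)
Lemma maya_sA m i la : (1 < m)%N -> is_part la ->
  (forall p, maya la p -> maya la (p - m%:Z)) ->
  is_part (sA m i la) /\ forall p, maya (sA m i la) p = maya la (slide m i p).
Proof.
move=> m1 hla closed; have sla := part_sorted hla.
have closedk k p : maya la p -> maya la (p - k%:Z * m%:Z).
  move=> h; elim: k => [|k IH]; first by rewrite mul0r subr0.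
  by have := closed _ IH; congr (maya la _); lia.
have mb u : maya la (bead la u) by apply/mayaP; exists u.
rewrite /sA; case: ifPn => [/hasP[a _]|noadd].
  rewrite addableE // => /andP[ha1 ha2].
  (* No box of this residue can be removed. *)
  have norem p : maya la p -> (p == i.+1%:Z %[mod m%:Z])%Z -> maya la (p - 1).
    move=> hp; rewrite -addn1 PoszD -[p](subrK 1) eqz_modD1 -(eqP ha1) addrK.
    rewrite eqz_mod_dvd => /dvdzP[k Ek]; case: (lerP 0 k) => hk.
      apply: contraNT ha2 => _; have := closedk `|k|%N _ hp.
      by congr (maya la _); lia.
    have := closedk `|k|%N _ (mb a); congr (maya la _); lia.
  have [|u hu|hpart hnth] := @shift_rowsP la (fun u => nth 0 la u + addable m i la u)%N.
  - move=> u; have := nth_geq sla (leqnSn u).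
    by rewrite {1}/addable /=; case: ltnP; case: has_residue; case: addable => /=; lia.
  - by rewrite /addable !nth_default //; [case: u hu|lia..].
  split=> //; apply: maya_moved; first exact: slideK.
  move=> u; have -> : bead (shift_rows la (fun u => nth 0 la u + addable m i la u)%N) u
      = bead la u + (addable m i la u)%:Z by rewrite /bead hnth; lia.
  rewrite addableE // /slide.
  case: (boolP (_ == i%:Z %[mod _])%Z) => h1 /=.
    by case: (maya la _); rewrite /= ?addr0.
  rewrite addr0; case: (boolP (_ == i.+1%:Z %[mod _])%Z) => h2; last by rewrite mb.
  by rewrite norem.
have noadd' p : maya la p -> (p == i%:Z %[mod m%:Z])%Z -> maya la (p + 1).
  move=> /mayaP[u <-] h; case: (leqP u (size la)) => hu; last first.
    by apply/mayaP; exists u.-1; rewrite /bead !nth_default; lia.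
  apply: contraNT noadd => h'; apply/hasP; exists u.
    by rewrite mem_iota.
  by rewrite addableE // h.
have [|u hu|hpart hnth] := @shift_rowsP la (fun u => nth 0 la u - removable m i la u)%N.
- move=> u; have := nth_geq sla (leqnSn u).
  by rewrite {2}/removable /=; case: ltnP; case: has_residue; case: removable => /=; lia.
- by rewrite nth_default //; lia.
split=> //; apply: maya_moved; first exact: slideK.
move=> u; have -> : bead (shift_rows la (fun u => nth 0 la u - removable m i la u)%N) u
    = bead la u - (removable m i la u)%:Z.
  by rewrite /bead hnth /removable; case: ltnP; case: has_residue => /=; lia.
rewrite removableE // /slide; case: (boolP (_ == i%:Z %[mod _])%Z) => h1.
  rewrite noadd' //; have := neqz_modS i%:Z m1.
  by rewrite -PoszD addn1 -(eqP h1) => ->; rewrite subr0.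
case: (boolP (_ == i.+1%:Z %[mod _])%Z) => h2 /=; last by rewrite mb subr0.
by case: (maya la _); rewrite /= ?subr0.
Qed.

(** * Words of vectors and their partitions *)

Lemma position_split m (p : int) : (0 < m)%N ->
  exists (k : int) (j : 'I_m), p = k * m%:Z + j.+1%:Z.
Proof.
move=> m0; have mZ : m%:Z != 0 by lia.
have hr0 := modz_ge0 (p - 1) mZ.
have hrm : ((p - 1) %% m%:Z)%Z < m%:Z by apply: ltz_pmod; lia.
have hE := divz_eq (p - 1) m%:Z.
have hj : (`|((p - 1) %% m%:Z)%Z|%N < m)%N by lia.
exists ((p - 1) %/ m%:Z)%Z, (Ordinal hj) => /=.
by rewrite -addn1 PoszD gez0_abs // addrA -hE subrK.
Qed.

(** Extension of the coordinates to all positions: position [j] carries the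
    [j]-th coordinate for [1 <= j <= m], and moving by [m] decreases the value by
    [1]. *)
Definition qext m (q : 'rV[int]_m) (p : int) : int :=
  \sum_(j < m | j%:Z == ((p - 1) %% m%:Z)%Z) q 0 j - ((p - 1) %/ m%:Z)%Z.

Lemma qextE m (q : 'rV[int]_m) k (j : 'I_m) :
  qext q (k * m%:Z + j.+1%:Z) = q 0 j - k.
Proof.
have jm := ltn_ord j; have mZ : m%:Z != 0 by lia.
rewrite /qext (_ : _ - 1 = k * m%:Z + j%:Z); last by rewrite -addn1 PoszD; ring.
rewrite modzMDl modz_small; last lia.
rewrite divzMDl // divz_small ?addr0; last lia.
by rewrite (big_pred1 j) // => i; rewrite eqz_nat.
Qed.

Lemma bulletE m (q : 'rV[int]_m) k (j : 'I_m) :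
  bullet q (k * m%:Z + j.+1%:Z) = (k < q 0 j).
Proof.
have jm := ltn_ord j; have mZ : m%:Z != 0 by lia.
apply/existsP/idP => [[i /andP[/dvdzP[d Ed]]]|kq].
  rewrite Ed mulzK // => hd; have hi := ltn_ord i.
  have E : k = d by nia.
  by rewrite (_ : j = i); [lia | apply/val_inj => /=; lia].
by exists j; rewrite addrK dvdz_mull //= mulzK //; lia.
Qed.

Lemma bullet_qext m (q : 'rV[int]_m) p : (0 < m)%N -> bullet q p = (0 < qext q p).
Proof.
move=> m0; have [k [j ->]] := position_split p m0.
by rewrite bulletE qextE; lia.
Qed.

Lemma bullet_inj m (q q' : 'rV[int]_m) : (0 < m)%N ->
  bullet q =1 bullet q' -> q = q'.
Proof.
move=> m0 E; apply/rowP => j.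
have h k : (k < q 0 j) = (k < q' 0 j) by rewrite -!bulletE E.
by have := h (q 0 j); have := h (q' 0 j); rewrite !ltxx; lia.
Qed.

Lemma qext_addm m (q : 'rV[int]_m) p k : (0 < m)%N ->
  qext q (p + k * m%:Z) = qext q p - k.
Proof.
move=> m0; have [l [j ->]] := position_split p m0.
rewrite (_ : _ + k * m%:Z = (l + k) * m%:Z + j.+1%:Z); last by ring.
by rewrite !qextE; ring.
Qed.

(** The range and the order of [positions]. *)
Definition window (M : nat) : seq int := [seq M%:Z - k%:Z | k <- iota 0 (M + M)].

Lemma positionsE m (q : 'rV[int]_m) : positions q = window (m * word_bound q).
Proof. by []. Qed.

Lemma nth_window M k : (k < M + M)%N -> nth 0 (window M) k = M%:Z - k%:Z.
Proof. by move=> hk; rewrite (nth_map 0%N) ?size_iota // nth_iota. Qed.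

Lemma size_window M : size (window M) = (M + M)%N.
Proof. by rewrite size_map size_iota. Qed.

Lemma mem_window M p : (p \in window M) = (- M%:Z < p <= M%:Z).
Proof.
apply/mapP/idP => [[k]|hp]; first by rewrite mem_iota => /andP[_ hk] ->; lia.
by exists `|M%:Z - p|%N; rewrite ?mem_iota; lia.
Qed.

Lemma window_sorted M : sorted >%O (window M).
Proof.
apply/(sortedP 0) => k; rewrite size_window => hk; rewrite !nth_window //; lia.
Qed.

Lemma sum_window m N (F : int -> int) :
  \sum_(p <- window (m * N)) F p =
  \sum_(j < m) \sum_(0 <= k < N + N) F ((k%:Z - N%:Z) * m%:Z + j.+1%:Z).
Proof.
have -> : window (m * N) = [seq (m * N)%:Z - k%:Z | k <- index_iota 0 ((N + N) * m)].
  by rewrite /window /index_iota subn0 mulnDl !(mulnC N).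
rewrite big_map big_nat_rev big_nat_mul exchange_big /=.
apply: eq_big_nat => k hk.
rewrite -{1}[(k * m)%N]add0n big_addn mulSn addnK big_mkord.
apply: eq_bigr => j _; congr F; have := ltn_ord j; nia.
Qed.

Lemma count_lt_nth_gt (s : seq int) i : sorted >%O s -> (i < size s)%N ->
  count (fun x => x < nth 0 s i) s = (size s - i.+1)%N.
Proof.
move=> ss hi; rewrite -[LHS]count_rev.
have hi' : (size s - i.+1 < size (rev s))%N by rewrite size_rev; lia.
have ss' : sorted <%O (rev s) by rewrite rev_sorted.
have := count_lt_nth 0 ss' hi'.
rewrite nth_rev; last by rewrite size_rev in hi'.
by rewrite (_ : (size s - (size s - i.+1).+1)%N = i) //; lia.
Qed.

(** In each residue class the bullets form an initial segment of the window, of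
    length [q_j + N]. *)
Lemma sum_bullets m N (q : 'rV[int]_m) (F : int -> int) :
  (forall j, - N%:Z <= q 0 j <= N%:Z) ->
  \sum_(p <- window (m * N) | bullet q p) F p =
  \sum_(j < m) \sum_(0 <= k < `|q 0 j + N%:Z|) F ((k%:Z - N%:Z) * m%:Z + j.+1%:Z).
Proof.
move=> hN; rewrite big_mkcond sum_window; apply: eq_bigr => j _.
have {}hN := hN j.
rewrite (@big_nat_widen _ _ _ 0 `|q 0 j + N%:Z| (N + N)) /=; last lia.
rewrite [RHS]big_mkcond; apply: eq_big_nat => k hk; rewrite bulletE.
by have -> : (k%:Z - N%:Z < q 0 j) = (k < `|(q 0 j + N%:Z)%R|)%N by lia.
Qed.

Definition bullets m (q : 'rV[int]_m) := [seq p <- positions q | bullet q p].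

Lemma bullets_sorted m (q : 'rV[int]_m) : sorted >%O (bullets q).
Proof. by apply: sorted_filter (window_sorted _) => a b c /= h1 h2; apply: lt_trans h1. Qed.

Lemma size_bullets m (q : 'rV[int]_m) :
  (size (bullets q))%:Z = \sum_j q 0 j + (m * word_bound q)%:Z.
Proof.
rewrite -sum1_size big_filter (big_morph Posz PoszD (erefl _)).
rewrite positionsE (sum_bullets (fun=> 1) (word_bound_ge q)) PoszM.
rewrite (eq_bigr (fun j => q 0 j + (word_bound q)%:Z)) => [|j _].
  by rewrite big_split /= sumr_const card_ord -mulr_natl natz.
have := word_bound_ge q j; rewrite sumr_const_nat; lia.
Qed.

Lemma count_predID (T : Type) (a b : pred T) s :
  count a s = (count (fun x => a x && b x) s + count (fun x => a x && ~~ b x) s)%N.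
Proof. by elim: s => //= x s ->; case: (a x); case: (b x) => /=; lia. Qed.

Lemma maya_tail la p : is_part la -> p <= - (size la)%:Z -> maya la p.
Proof. by move=> hla hp; apply/mayaP; exists `|p|%N; rewrite /bead nth_default; lia. Qed.

(** There are [p + M - 1] positions of the window below [p], and [M - u - 1] of them
    are bullets, because the window contains [M] bullets in total. *)
Lemma holes_before_nth m (q : 'rV[int]_m) u :
  corootA q -> (u < m * word_bound q)%N ->
  (holes_before q (nth 0 (bullets q) u))%:Z = nth 0 (bullets q) u + u%:Z.
Proof.
move=> hq hu; set M := (m * word_bound q)%N in hu *.
have sz : size (bullets q) = M by have := size_bullets q; rewrite hq add0r; lia.
set p := nth _ _ _.
have : p \in bullets q by rewrite mem_nth ?sz.
rewrite mem_filter => /andP[_ hp]; have hp2 := hp.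
rewrite positionsE mem_window in hp2.
have c1 : count (fun x => x < p) (bullets q) = (M - u.+1)%N.
  by rewrite count_lt_nth_gt ?bullets_sorted // sz.
have hi : (`|M%:Z - p| < M + M)%N by lia.
have := @count_lt_nth_gt (window M) `|M%:Z - p|%N (window_sorted M).
rewrite size_window nth_window // => /(_ hi).
rewrite (_ : M%:Z - `|M%:Z - p|%N%:Z = p); last lia.
rewrite (count_predID _ (bullet q)).
have -> : count (fun x => (x < p) && bullet q x) (window M) = (M - u.+1)%N.
  by rewrite -c1 count_filter.
by rewrite /holes_before positionsE -/M; move: (count _ _) => c; lia.
Qed.

(** By [holes_before_nth], the [u]-th part of [lambda q] is [p + u] for the [u]-th
    bullet [p], that is, its bead is [p]; the rows beyond the window are empty and
    their beads are the constant part of the word. *)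
Lemma lambda_bullets m (q : 'rV[int]_m) : (0 < m)%N -> corootA q ->
  [/\ is_part (lambda q),
      forall u, (u < m * word_bound q)%N -> bead (lambda q) u = nth 0 (bullets q) u
    & maya (lambda q) =1 bullet q].
Proof.
move=> m0 hq; set M := (m * word_bound q)%N.
have sz : size (bullets q) = M by have := size_bullets q; rewrite hq add0r; lia.
set t := [seq holes_before q p | p <- bullets q].
have nt u : (u < M)%N -> (nth 0%N t u)%:Z = nth 0 (bullets q) u + u%:Z.
  by move=> hu; rewrite (nth_map 0) ?sz // holes_before_nth.
have st : sorted geq t.
  apply/(sortedP 0%N) => u; rewrite size_map sz => hu.
  have /(sortedP 0)/(_ u) := bullets_sorted q; rewrite sz => /(_ hu) /=.
  by have := nt u (ltnW hu); have := nt _ hu; rewrite /=; lia.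
have hbead u : (u < M)%N -> bead (lambda q) u = nth 0 (bullets q) u.
  by move=> hu; rewrite /bead nth_filter_gt0 // nt // addrK.
split=> //; first exact: part_filter_gt0.
move=> p; apply/mayaP/idP => [[u <-]|hp].
  case: (ltnP u M) => hu.
    rewrite hbead //.
    have : nth 0 (bullets q) u \in bullets q by rewrite mem_nth ?sz.
    by rewrite mem_filter => /andP[].
  apply: bullet_low => //; rewrite -/M.
  by rewrite /bead nth_filter_gt0 // nth_default ?size_map ?sz //; lia.
have hpM : p <= M%:Z by rewrite leNgt; apply: contraTN hp; apply: bullet_high.
case: (lerP p (- M%:Z)) => hM.
  exists `|p|%N.
  by rewrite /bead nth_filter_gt0 // nth_default ?size_map ?sz //; lia.
have /(nthP 0)[u hu <-] : p \in bullets q.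
  by rewrite mem_filter hp positionsE mem_window hM.
by rewrite sz in hu; exists u; rewrite hbead.
Qed.

(** * Counting boxes *)

Lemma sum_nonpos M (F : int -> int) :
  \sum_(p <- window M | p <= 0) F p = \sum_(0 <= u < M) F (- u%:Z).
Proof.
rewrite /window iotaD map_cat big_cat /= !big_map.
rewrite big1_seq => [|k /andP[hk]]; last by rewrite mem_iota; lia.
rewrite add0r add0n (_ : iota M M = [seq (M + k)%N | k <- iota 0 M]); last first.
  by rewrite -iotaDl addn0.
rewrite big_map /index_iota subn0.
rewrite big_mkcond; apply: eq_bigr => k _.
by rewrite PoszD opprD addrA subrr add0r; case: ifP => //; lia.
Qed.

(** The contents of row [u] are the consecutive integers from [- u] to the
    position before its bead, so the count telescopes. *)
Lemma count_boxes (a : pred (nat * nat)) (F : int -> int) la M :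
  (forall b, (a b)%:Z = F (content b + 1) - F (content b)) -> (size la <= M)%N ->
  (count a (boxes la))%:Z = \sum_(0 <= u < M) (F (bead la u) - F (- u%:Z)).
Proof.
move=> aF hM.
have row u r : (count a [seq (u, v) | v <- iota 0 r])%:Z = F (r%:Z - u%:Z) - F (- u%:Z).
  elim: r => [|r IH]; first by rewrite add0r subrr.
  rewrite -addn1 iotaD map_cat count_cat PoszD IH /= addn0 aF add0n /content /=.
  by rewrite PoszD (addrAC r%:Z); ring.
rewrite count_flatten sumnE !big_map (big_morph Posz PoszD (erefl _)).
rewrite (big_cat_nat _ hM) //= [X in _ = _ + X]big1_seq ?addr0; last first.
  by move=> u /=; rewrite mem_index_iota => hu; rewrite /bead nth_default ?add0r ?subrr //; lia.
by rewrite /index_iota subn0; apply: eq_bigr => u _; rewrite row.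
Qed.

Lemma bullet0 m p : (0 < m)%N -> bullet (0 : 'rV[int]_m) p = (p <= 0).
Proof.
move=> m0; have [k [j ->]] := position_split p m0; rewrite bulletE mxE.
by have := ltn_ord j; nia.
Qed.

(** The subtracted sums are those of the zero vector, whose bullets are the
    nonpositive positions [- u]. *)
Lemma count_lambda m (q : 'rV[int]_m) (a : pred (nat * nat)) (F : int -> int) :
  (0 < m)%N -> corootA q ->
  (forall b, (a b)%:Z = F (content b + 1) - F (content b)) ->
  let N := word_bound q in
  let f j k := F ((k%:Z - N%:Z) * m%:Z + j.+1%:Z) in
  (count a (boxes (lambda q)))%:Z =
  \sum_(j < m) (\sum_(0 <= k < `|q 0 j + N%:Z|) f j k - \sum_(0 <= k < N) f j k).
Proof.
move=> m0 hq aF N f; have [hla hb hm] := lambda_bullets m0 hq.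
have sz : size (bullets q) = (m * N)%N by have := size_bullets q; rewrite hq add0r; lia.
have szla : (size (lambda q) <= m * N)%N.
  rewrite size_filter; apply: leq_trans (count_size _ _) _.
  by rewrite size_map sz.
rewrite (count_boxes aF szla) sumrB sumrB; congr (_ - _).
  transitivity (\sum_(p <- bullets q) F p).
    rewrite [RHS](big_nth 0) sz; apply: eq_big_nat => u /andP[_ hu].
    by rewrite hb.
  by rewrite big_filter positionsE (sum_bullets _ (word_bound_ge q)).
rewrite -sum_nonpos -(eq_bigl _ _ (fun p => bullet0 p m0)) (@sum_bullets _ N) => [|j].
  by apply: eq_bigr => j _; rewrite mxE add0r.
by rewrite mxE; lia.
Qed.

Lemma divz_step (m p : int) : 0 < m -> ((p %/ m)%Z - ((p - 1) %/ m)%Z) = (m %| p)%Z%:Z.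
Proof.
move=> m0; have mZ : m != 0 by lia.
have E := divz_eq p m; have r0 := modz_ge0 p mZ; have rm := ltz_pmod p m0.
rewrite {2}E -addrA divzMDl // opprD addrA subrr add0r.
have -> : (m %| p)%Z = ((p %% m)%Z == 0) by apply/dvdz_mod0P/eqP.
case: eqP => [->|/eqP h]; last by rewrite divz_small //; lia.
rewrite add0r (_ : -1 = -1 * m + (m - 1)); last by ring.
by rewrite divzMDl // divz_small //; lia.
Qed.

Lemma sum_shifted a c :
  2%:Z * \sum_(0 <= k < a) (k%:Z - c) = a%:Z * (a%:Z - 1) - 2%:Z * a%:Z * c.
Proof.
elim: a => [|a IH]; first by rewrite big_nil; ring.
by rewrite big_nat_recr //= mulrDr IH; lia.
Qed.

(** Here [F p = floor ((p - 1 - i) / m)] jumps exactly after the contents congruent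
    to [i]; on class [j] it is [k - N - [j < i]] at the [k]-th position of the window,
    and the sums of these arithmetic progressions give the quadratic form. *)
Lemma size_res_lambda m i (q : 'rV[int]_m) : (0 < m)%N -> (i < m)%N -> corootA q ->
  2%:Z * (psize_res m i (lambda q))%:Z =
  \sum_j q 0 j ^+ 2 - 2%:Z * \sum_(j < m | (j < i)%N) q 0 j.
Proof.
move=> m0 im hq; have mZ : m%:Z != 0 by lia.
rewrite /psize_res (@count_lambda _ _ _ (fun p => ((p - 1 - i%:Z) %/ m%:Z)%Z)) //.
  set N := word_bound q.
  have f (j : 'I_m) k : (((k%:Z - N%:Z) * m%:Z + j.+1%:Z - 1 - i%:Z) %/ m%:Z)%Z =
      k%:Z - (N%:Z + (j < i)%N%:Z).
    have jm := ltn_ord j.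
    rewrite (_ : _ - i%:Z = (k%:Z - N%:Z) * m%:Z + (j%:Z - i%:Z)); last by lia.
    rewrite divzMDl // opprD addrA; congr (_ + _); case: ltnP => ji.
      rewrite (_ : j%:Z - i%:Z = -1 * m%:Z + (m + j - i)%N%:Z); last lia.
      by rewrite divzMDl // divz_small //; lia.
    by rewrite divz_small; lia.
  transitivity (\sum_j (q 0 j ^+ 2 - q 0 j - 2%:Z * (if (j < i)%N then q 0 j else 0))).
    rewrite mulr_sumr; apply: eq_bigr => j _.
    under eq_bigr do rewrite f.
    under [X in _ - X]eq_bigr do rewrite f.
    rewrite mulrBr !sum_shifted gez0_abs; last by have := word_bound_ge q j; lia.
    by case: ltnP => _ /=; ring.
  rewrite !sumrB hq subr0 -mulr_sumr -big_mkcond //.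
move=> b; rewrite /has_residue eqz_mod_dvd -divz_step; last lia.
by congr ((_ %/ _)%Z - (_ %/ _)%Z); lia.
Qed.

(** The primitive of the indicator of content [0] is the indicator of the positive
    positions. *)
Lemma ndiag_lambda m (q : 'rV[int]_m) : (0 < m)%N -> corootA q ->
  (ndiag (lambda q))%:Z = \sum_j (if 0 <= q 0 j then q 0 j else 0).
Proof.
move=> m0 hq; rewrite /ndiag (@count_lambda _ _ _ (fun p => (0 < p)%R%:Z)) //.
  set N := word_bound q; apply: eq_bigr => j _.
  have f k : (0 < (k%:Z - N%:Z) * m%:Z + j.+1%:Z) = (N <= k)%N.
    by have := ltn_ord j; nia.
  under eq_bigr do rewrite f.
  under [X in _ - X]eq_bigr do rewrite f.
  have S a : \sum_(0 <= k < a) (N <= k)%N%:Z = (a - N)%N%:Z.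
    elim: a => [|a IH]; first by rewrite big_nil.
    by rewrite big_nat_recr //= IH; lia.
  by rewrite !S; have := word_bound_ge q j; case: ifP; lia.
by move=> [u v]; rewrite /content /=; lia.
Qed.

Lemma sum_psize_res m la : (0 < m)%N -> (\sum_(i < m) psize_res m i la)%N = psize la.
Proof.
move=> m0; rewrite /psize /psize_res; elim: (boxes la) => [|b s IH] /=.
  by rewrite big1.
rewrite big_split /= IH -add1n; congr (_ + _)%N.
have mZ : m%:Z != 0 by lia.
have r0 := modz_ge0 (content b) mZ.
have rm : (content b %% m%:Z)%Z < m%:Z by apply: ltz_pmod; lia.
have hj : (`|(content b %% m%:Z)%Z|%N < m)%N by lia.
rewrite (bigD1 (Ordinal hj)) //= big1 => [|i ni].
  by rewrite /has_residue gez0_abs // modz_mod eqxx.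
rewrite /has_residue [(i%:Z %% _)%Z]modz_small; last by have := ltn_ord i; lia.
case: eqP => // E; case/eqP: ni; apply/val_inj => /=; lia.
Qed.

(** * Cores are the partitions of balanced vectors *)

Lemma bullet_closed m (q : 'rV[int]_m) p :
  (0 < m)%N -> bullet q p -> bullet q (p - m%:Z).
Proof.
move=> m0; rewrite !bullet_qext // (_ : p - m%:Z = p + -1 * m%:Z) ?qext_addm //; lia.
Qed.

Lemma lambda_core m (q : 'rV[int]_m) : (0 < m)%N -> corootA q -> is_core m (lambda q).
Proof.
move=> m0 hq; have [hla _ hm] := lambda_bullets m0 hq.
apply/core_maya => // p; rewrite !hm; exact: bullet_closed.
Qed.

Lemma maya_le la p : is_part la -> maya la p -> p <= (nth 0%N la 0)%:Z.
Proof.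
move=> hla /mayaP[u <-]; have := nth_geq (part_sorted hla) (leq0n u).
rewrite /bead; lia.
Qed.

(** Stability under [p |-> p - m] leaves only the choice of the level at which the
    beads of a residue class stop. *)
Lemma maya_runner m la (j : 'I_m) : is_part la ->
  (forall p, maya la p -> maya la (p - m%:Z)) ->
  exists l : int, forall k, maya la (k * m%:Z + j.+1%:Z) = (k < l).
Proof.
move=> hla closed; have jm := ltn_ord j.
(* The offset puts [c 0] in the constant part of the diagram. *)
pose c (k : nat) := (k%:Z - (size la).+1%:Z) * m%:Z + j.+1%:Z.
have ex : exists k, ~~ maya la (c k).
  exists ((size la).+1 + nth 0 la 0)%N; apply/negP => /(maya_le hla).
  by rewrite /c PoszD addrAC subrr; nia.
have [k0 hk0 kmin] := ex_minnP ex; exists (k0%:Z - (size la).+1%:Z) => k.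
case: ltP => hk.
  have [hk'|hk'] := lerP k (- (size la).+1%:Z).
    by apply: maya_tail => //; nia.
  apply/negPn/negP => h; have := kmin `|(k + (size la).+1%:Z)%R|%N.
  rewrite /c gez0_abs ?addrK; last lia.
  by move=> /(_ h); lia.
apply: contraNF hk0 => h; rewrite /c.
have {h} : forall d : nat, maya la ((k - d%:Z) * m%:Z + j.+1%:Z).
  elim=> [|d IH]; first by rewrite subr0.
  by have := closed _ IH; congr (maya la _); lia.
by move=> /(_ `|(k - (k0%:Z - (size la).+1%:Z))%R|%N); congr (maya la _); lia.
Qed.

(** The levels of the residue classes form a vector [q] with the word of [la].
    Its coordinates add up to [0] because the bullets of the window are exactly
    the beads of the first [M] rows. *)
Lemma core_lambda m la : (0 < m)%N -> is_core m la ->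
  exists2 q : 'rV[int]_m, corootA q & lambda q = la.
Proof.
move=> m0 hc; have hla : is_part la by case/andP: hc.
have /core_maya closed := hc.
have [f hf] := fin_all_exists (fun j => maya_runner j hla (closed hla m0)).
pose q : 'rV[int]_m := \row_j f j.
have hm : maya la =1 bullet q.
  by move=> p; have [k [j ->]] := position_split p m0; rewrite bulletE hf mxE.
set M := (m * word_bound q)%N.
(* Otherwise the first hole, at [1 - size la], would lie in the part of the word
   where all positions carry bullets. *)
have hM : (size la <= M)%N.
  rewrite leqNgt; apply/negP => hM.
  have hs : ((size la).-1 < size la)%N by lia.
  have := nth_part_gt0 hla hs => hgt.
  have /mayaP[u] : maya la (1 - (size la)%:Z).
    by rewrite hm; apply: bullet_low; rewrite -/M //; lia.
  case: (ltnP u (size la)) => hu.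
    have hu' : (u <= (size la).-1)%N by lia.
    by have := nth_geq (part_sorted hla) hu'; rewrite /bead; lia.
  by rewrite /bead nth_default //; lia.
have beadM : bead la M = - M%:Z by rewrite /bead nth_default ?add0r.
have E : bullets q = [seq bead la u | u <- iota 0 M].
  apply: (irr_sorted_eq (leT := >%O)) (bullets_sorted q) _ _.
  - by move=> a b d /= h1 h2; apply: lt_trans h1.
  - by move=> a /=; rewrite ltxx.
  - apply/(sortedP 0) => u; rewrite size_map size_iota => hu.
    rewrite !(nth_map 0%N) ?size_iota ?nth_iota //; try lia.
    exact: bead_lt.
  move=> p; rewrite mem_filter positionsE mem_window -/M -hm.
  apply/andP/mapP => [[/mayaP[u <-] hp]|[u]].
    exists u => //; rewrite mem_iota add0n /= ltnNge; apply/negP => hu.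
    have : bead la u <= bead la M.
      by move: hu; rewrite leq_eqVlt => /orP[/eqP-> //|/(bead_lt hla)/ltW].
    by lia.
  rewrite mem_iota => /andP[_ hu] ->.
  have hu' : maya la (bead la u) by apply/mayaP; exists u.
  split=> //; rewrite -beadM bead_lt //=.
  rewrite leNgt; apply: contraTN hu'; rewrite hm; exact: bullet_high.
have hq : corootA q.
  by have := size_bullets q; rewrite -/M E size_map size_iota => EM;
    apply: (@addIr _ M%:Z); rewrite -EM add0r.
exists q => //; have [h1 _ h2] := lambda_bullets m0 hq.
by apply: maya_inj => // p; rewrite h2 hm.
Qed.

(** * The symmetry of type D vectors *)

Lemma iotaQ_rev n (x : 'rV[int]_n) j : iotaQ x 0 (rev_ord j) = - iotaQ x 0 j.
Proof.
rewrite /iotaQ; have [i ->|i ->] := split_ordP j.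
  have -> : rev_ord (lshift n i) = rshift n (rev_ord i).
    by apply/val_inj; have := ltn_ord i => /=; lia.
  by rewrite row_mxEl row_mxEr mxE rev_ordK.
have -> : rev_ord (rshift n i) = lshift n (rev_ord i).
  by apply/val_inj; have := ltn_ord i => /=; lia.
by rewrite row_mxEl row_mxEr mxE opprK.
Qed.

Lemma position_rev m k (j : 'I_m) :
  1 - (k * m%:Z + j.+1%:Z) = (- k - 1) * m%:Z + (rev_ord j).+1%:Z.
Proof. by have := ltn_ord j; rewrite /=; lia. Qed.

Lemma antisym_iotaQ n (q : 'rV[int]_(n + n)) :
  (forall j, q 0 (rev_ord j) = - q 0 j) -> iotaQ (lsubmx q) = q.
Proof.
move=> hq; rewrite /iotaQ -[RHS]hsubmxK; congr row_mx; apply/rowP => j.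
rewrite !mxE -hq; congr (q 0 _); apply/val_inj => /=; have := ltn_ord j; lia.
Qed.

(** The symmetry that characterizes the image of [iotaQ]. *)
Lemma qext_iotaQ_rev n (x : 'rV[int]_n) p : (0 < n)%N ->
  qext (iotaQ x) (1 - p) = 1 - qext (iotaQ x) p.
Proof.
move=> n0; have n20 : (0 < n + n)%N by lia.
have [k [j ->]] := position_split p n20.
by rewrite position_rev !qextE iotaQ_rev; ring.
Qed.

Lemma qext_coordD n (x : 'rV[int]_n) (k : nat) : (0 < k <= n)%N ->
  qext (iotaQ x) k%:Z = coordD x k.
Proof.
move=> hk; have hj : (k.-1 < n)%N by lia.
have Ek : k = (Ordinal hj).+1 by rewrite /=; lia.
rewrite /coordD (big_pred1 (Ordinal hj)) => [|i]; last first.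
  by rewrite /= -val_eqE /=; lia.
have := qextE (iotaQ x) 0 (lshift n (Ordinal hj)).
by rewrite mul0r add0r subr0 /iotaQ row_mxEl => <-; congr qext; rewrite /=; lia.
Qed.

Lemma coordD_of n f (k : nat) : (0 < k <= n)%N -> coordD (of_coordD n f) k = f k.
Proof.
move=> hk; have hj : (k.-1 < n)%N by lia.
rewrite /coordD (big_pred1 (Ordinal hj)) => [|i]; last first.
  by rewrite /= -val_eqE /=; lia.
by rewrite mxE /= prednK //; lia.
Qed.

(** * The generators of type D as exchanges of positions *)

Definition slides m (s : seq nat) (p : int) := foldl (fun p i => slide m i p) p s.

Lemma slidesD m s p k : slides m s (p + k * m%:Z) = slides m s p + k * m%:Z.
Proof. by elim: s p => //= i s IH p; rewrite slideD IH. Qed.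

Lemma slide_rev m i p : (1 < m)%N -> (i <= m)%N -> slide m i (1 - p) = 1 - slide m (m - i) p.
Proof.
move=> m1 im; rewrite /slide !eqz_mod_dvd.
have -> : (m%:Z %| 1 - p - i%:Z)%Z = (m%:Z %| p - (m - i).+1%:Z)%Z.
  by apply/dvdzP/dvdzP => -[k E]; exists (- k - 1); rewrite mulrBl mulNr -E; lia.
have -> : (m%:Z %| 1 - p - i.+1%:Z)%Z = (m%:Z %| p - (m - i)%N%:Z)%Z.
  by apply/dvdzP/dvdzP => -[k E]; exists (- k - 1); rewrite mulrBl mulNr -E; lia.
have := neqz_modS (m - i)%N%:Z m1; rewrite -PoszD addn1 eqz_mod_dvd.
case: ifP => h1; case: ifP => h2; try by move=> _; ring.
move: (rpredB h1 h2).
rewrite (_ : p - _ - _ = (m - i)%N%:Z - (m - i).+1%:Z); last by ring.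
by move=> ->.
Qed.

Lemma slides_rev m s p : (1 < m)%N -> all (fun i => i <= m)%N s ->
  slides m s (1 - p) = 1 - slides m [seq (m - i)%N | i <- s] p.
Proof.
move=> m1; elim: s p => //= i s IH p /andP[im hs]; rewrite slide_rev //; exact: IH.
Qed.

Lemma eqz_mod_small (m a b : int) : - m < a - b < m -> (a == b %[mod m])%Z = (a == b).
Proof.
move=> hab; apply/idP/eqP => [|->//]; rewrite eqz_mod_dvd => /dvdzP[k E].
have k0 : k = 0 by nia.
by move: E; rewrite k0; lia.
Qed.

(** Congruence modulo [m] becomes equality for positions that are close to a
    representative [a] of [i]. *)
Lemma slide_near m i (a p p' : int) : (i%:Z == a %[mod m%:Z])%Z ->
  1 - m%:Z < p - a < m%:Z ->
  p = a /\ p' = p + 1 \/ p = a + 1 /\ p' = p - 1 \/ p <> a /\ p <> a + 1 /\ p' = p ->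
  slide m i p = p'.
Proof.
move=> ia hp hp'; rewrite /slide -addn1 PoszD (eqP ia).
have -> : (p == i%:Z + 1 %[mod m%:Z])%Z = (p - 1 == i%:Z %[mod m%:Z])%Z.
  by rewrite -[in LHS](subrK 1 p) eqz_modD1.
rewrite (eqP ia) !eqz_mod_small; try lia.
by case: eqP => h1; [|case: eqP => h2]; lia.
Qed.

(** The generators of type A that compose to the [i]-th generator of type D, in
    the order in which they are written. *)
Definition sD_word (n i : nat) : seq nat :=
  let m := (n + n)%N in
  if i == 0%N then [:: 0; 1; m.-1; 0]%N
  else if i == n then [:: n; n.-1; n.+1; n]
  else [:: i; (m - i)%N].

Lemma sD_coreE n i la : sD_core n i la = foldr (sA (n + n)) la (sD_word n i).
Proof. by rewrite /sD_core /sD_word; case: ifP => // _; case: ifP. Qed.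

Lemma maya_sA_word m s la : (1 < m)%N -> is_part la ->
  (forall p, maya la p -> maya la (p - m%:Z)) ->
  is_part (foldr (sA m) la s) /\
  forall p, maya (foldr (sA m) la s) p = maya la (slides m s p).
Proof.
move=> m1 hla closed; elim: s => [|i s [h1 h2]] //=.
have closed' p : maya (foldr (sA m) la s) p -> maya (foldr (sA m) la s) (p - m%:Z).
  rewrite !h2 => /closed; rewrite (_ : p - m%:Z = p + -1 * m%:Z); last by ring.
  by rewrite slidesD; congr (maya la _); ring.
by have [h3 h4] := maya_sA i m1 h1 closed'; split=> // p; rewrite h4 h2.
Qed.

(** Periodicity reduces the identity to [1 <= p <= 2 n], and the reflection
    [p |-> 1 - p] exchanges the two halves of this range up to a period.  The
    reflection turns the [i]-th exchange into the [(m - i)]-th one, whence the second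
    hypothesis. *)
Lemma qext_iotaQ_eq n (x y : 'rV[int]_n) s : (0 < n)%N ->
  all (fun i => i <= n + n)%N s ->
  (forall k : nat, (0 < k <= n)%N ->
     qext (iotaQ y) k%:Z = qext (iotaQ x) (slides (n + n) s k%:Z) /\
     qext (iotaQ y) k%:Z =
       qext (iotaQ x) (slides (n + n) [seq (n + n - i)%N | i <- s] k%:Z)) ->
  forall p, qext (iotaQ y) p = qext (iotaQ x) (slides (n + n) s p).
Proof.
move=> n0 hs H p; have m1 : (1 < n + n)%N by lia.
have [k [j ->]] := position_split p (ltnW m1).
rewrite addrC slidesD !qext_addm; [congr (_ - _)|lia..].
case: (ltnP j n) => hj; first by have [] := H j.+1 hj.
have hj' : (0 < (rev_ord j).+1 <= n)%N by have := ltn_ord j; rewrite /=; lia.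
have [_ H'] := H _ hj'.
have -> : j.+1%:Z = 1 - ((rev_ord j).+1%:Z + (-1) * (n + n)%N%:Z).
  by have := ltn_ord j; rewrite /=; lia.
rewrite slides_rev // slidesD !qext_iotaQ_rev // !qext_addm; [|lia..].
by rewrite H'.
Qed.

Lemma qext_iotaQ_sub n (x : 'rV[int]_n) (k : nat) : (0 < k <= n)%N ->
  qext (iotaQ x) (1 - k%:Z) = 1 - coordD x k.
Proof. by move=> hk; rewrite qext_iotaQ_rev ?qext_coordD //; lia. Qed.

Lemma qext_iotaQ_add n (x : 'rV[int]_n) (k : nat) : (0 < k <= n)%N ->
  qext (iotaQ x) (n + n - k.-1)%N%:Z = - coordD x k.
Proof.
move=> hk; rewrite (_ : _%:Z = 1 - k%:Z + 1 * (n + n)%N%:Z); last lia.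
by rewrite qext_addm ?qext_iotaQ_sub; lia.
Qed.

(** One step of a computation of [slides]; [p'] is the position after the step. *)
Lemma slides_near m i s (a p p' r : int) : (i%:Z == a %[mod m%:Z])%Z ->
  1 - m%:Z < p - a < m%:Z ->
  p = a /\ p' = p + 1 \/ p = a + 1 /\ p' = p - 1 \/ p <> a /\ p <> a + 1 /\ p' = p ->
  slides m s p' = r -> slides m (i :: s) p = r.
Proof. by move=> ia hp hp' <-; rewrite /= (slide_near ia hp hp'). Qed.

(** The two words are those that [qext_iotaQ_eq] requires, with [z = 0] in the
    first one and [z = m] in the reflected one. *)
Lemma slides_affine m z k : (8 <= m)%N -> (0 < k)%N -> (k + k <= m)%N ->
  (z%:Z == 0 %[mod m%:Z])%Z ->
  let v : int := if k == 1%N then -1 else if k == 2%N then 0 else k%:Z in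
  slides m [:: z; 1; m.-1; z]%N k%:Z = v /\ slides m [:: z; m.-1; 1; z]%N k%:Z = v.
Proof.
move=> m8 k0 km e0.
have e1 : (m.-1%:Z == -1 %[mod m%:Z])%Z.
  by rewrite eqz_mod_dvd (_ : _ - -1 = m%:Z) ?dvdzz; lia.
have e2 := eqxx (1%N%:Z %% m%:Z)%Z.
have [->|nk1] := eqVneq k 1%N.
  split.
    apply: (slides_near (p' := 0) e0); [lia | lia |].
    apply: (slides_near (p' := 0) e2); [lia | lia |].
    apply: (slides_near (p' := (-1)) e1); [lia | lia |].
    apply: (slides_near (p' := (-1)) e0); [lia | lia |].
    by [].
  apply: (slides_near (p' := 0) e0); [lia | lia |].
  apply: (slides_near (p' := (-1)) e1); [lia | lia |].
  apply: (slides_near (p' := (-1)) e2); [lia | lia |].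
  apply: (slides_near (p' := (-1)) e0); [lia | lia |].
  by [].
have [->|nk2] := eqVneq k 2%N.
  split.
    apply: (slides_near (p' := 2) e0); [lia | lia |].
    apply: (slides_near (p' := 1) e2); [lia | lia |].
    apply: (slides_near (p' := 1) e1); [lia | lia |].
    apply: (slides_near (p' := 0) e0); [lia | lia |].
    by [].
  apply: (slides_near (p' := 2) e0); [lia | lia |].
  apply: (slides_near (p' := 2) e1); [lia | lia |].
  apply: (slides_near (p' := 1) e2); [lia | lia |].
  apply: (slides_near (p' := 0) e0); [lia | lia |].
  by [].
split.
  apply: (slides_near (p' := k) e0); [lia | lia |].
  apply: (slides_near (p' := k) e2); [lia | lia |].
  apply: (slides_near (p' := k) e1); [lia | lia |].
  apply: (slides_near (p' := k) e0); [lia | lia |].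
  by [].
apply: (slides_near (p' := k) e0); [lia | lia |].
apply: (slides_near (p' := k) e1); [lia | lia |].
apply: (slides_near (p' := k) e2); [lia | lia |].
apply: (slides_near (p' := k) e0); [lia | lia |].
by [].
Qed.

Lemma slides_spin n k : (4 <= n)%N -> (0 < k <= n)%N ->
  let v := if k == n.-1 then n.+1 else if k == n then n.+2 else k in
  slides (n + n) [:: n; n.-1; n.+1; n] k%:Z = v%:Z /\
  slides (n + n) [:: n; n.+1; n.-1; n] k%:Z = v%:Z.
Proof.
move=> n4 /andP[k0 kn]; set m := (n + n)%N; have hm : m = (n + n)%N by [].
have e0 := eqxx (n%:Z %% m%:Z)%Z.
have e1 := eqxx (n.-1%:Z %% m%:Z)%Z.
have e2 := eqxx (n.+1%:Z %% m%:Z)%Z.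
have [->|nk1] := eqVneq k n.-1.
  split.
    apply: (slides_near (p' := n.-1%:Z) e0); [lia | lia |].
    apply: (slides_near (p' := n%:Z) e1); [lia | lia |].
    apply: (slides_near (p' := n%:Z) e2); [lia | lia |].
    apply: (slides_near (p' := n.+1%:Z) e0); [lia | lia |].
    by [].
  apply: (slides_near (p' := n.-1%:Z) e0); [lia | lia |].
  apply: (slides_near (p' := n.-1%:Z) e2); [lia | lia |].
  apply: (slides_near (p' := n%:Z) e1); [lia | lia |].
  apply: (slides_near (p' := n.+1%:Z) e0); [lia | lia |].
  by [].
have [->|nk2] := eqVneq k n.
  split.
    apply: (slides_near (p' := n.+1%:Z) e0); [lia | lia |].
    apply: (slides_near (p' := n.+1%:Z) e1); [lia | lia |].
    apply: (slides_near (p' := n.+2%:Z) e2); [lia | lia |].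
    apply: (slides_near (p' := n.+2%:Z) e0); [lia | lia |].
    by [].
  apply: (slides_near (p' := n.+1%:Z) e0); [lia | lia |].
  apply: (slides_near (p' := n.+2%:Z) e2); [lia | lia |].
  apply: (slides_near (p' := n.+2%:Z) e1); [lia | lia |].
  apply: (slides_near (p' := n.+2%:Z) e0); [lia | lia |].
  by [].
split.
  apply: (slides_near (p' := k%:Z) e0); [lia | lia |].
  apply: (slides_near (p' := k%:Z) e1); [lia | lia |].
  apply: (slides_near (p' := k%:Z) e2); [lia | lia |].
  apply: (slides_near (p' := k%:Z) e0); [lia | lia |].
  by [].
apply: (slides_near (p' := k%:Z) e0); [lia | lia |].
apply: (slides_near (p' := k%:Z) e2); [lia | lia |].
apply: (slides_near (p' := k%:Z) e1); [lia | lia |].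
apply: (slides_near (p' := k%:Z) e0); [lia | lia |].
by [].
Qed.

Lemma slides_swap n i k : (0 < i < n)%N -> (0 < k <= n)%N ->
  let v := if k == i then i.+1 else if k == i.+1 then i else k in
  slides (n + n) [:: i; (n + n - i)%N] k%:Z = v%:Z /\
  slides (n + n) [:: (n + n - i)%N; i] k%:Z = v%:Z.
Proof.
move=> /andP[i0 hin] /andP[k0 kn]; set m := (n + n)%N; have hm : m = (n + n)%N by [].
have e0 := eqxx (i%:Z %% m%:Z)%Z.
have e1 := eqxx ((m - i)%N%:Z %% m%:Z)%Z.
have [->|nk1] := eqVneq k i.
  split.
    apply: (slides_near (p' := i.+1%:Z) e0); [lia | lia |].
    apply: (slides_near (p' := i.+1%:Z) e1); [lia | lia |].
    by [].
  apply: (slides_near (p' := i%:Z) e1); [lia | lia |].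
  apply: (slides_near (p' := i.+1%:Z) e0); [lia | lia |].
  by [].
have [->|nk2] := eqVneq k i.+1.
  split.
    apply: (slides_near (p' := i%:Z) e0); [lia | lia |].
    apply: (slides_near (p' := i%:Z) e1); [lia | lia |].
    by [].
  apply: (slides_near (p' := i.+1%:Z) e1); [lia | lia |].
  apply: (slides_near (p' := i%:Z) e0); [lia | lia |].
  by [].
split.
  apply: (slides_near (p' := k%:Z) e0); [lia | lia |].
  apply: (slides_near (p' := k%:Z) e1); [lia | lia |].
  by [].
apply: (slides_near (p' := k%:Z) e1); [lia | lia |].
apply: (slides_near (p' := k%:Z) e0); [lia | lia |].
by [].
Qed.

(** The positions [- 1] and [0] carry [1 - x_2] and [1 - x_1], and the positions
    [n + 1] and [n + 2] carry [- x_n] and [- x_(n - 1)]. *)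
Lemma qext_sD n i (x : 'rV[int]_n) : (4 <= n)%N -> (i <= n)%N ->
  forall p, qext (iotaQ (sD i x)) p = qext (iotaQ x) (slides (n + n) (sD_word n i) p).
Proof.
move=> n4 hi; apply: qext_iotaQ_eq; first lia.
  by rewrite /sD_word; case: ifP => _; [|case: ifP => _]; rewrite /=; lia.
move=> k hk; have [k0 kn] := andP hk.
rewrite qext_coordD // coordD_of // /sD_word.
have [_|i0] := eqVneq i 0%N.
  have e0 : (0%N%:Z == 0 %[mod (n + n)%N%:Z])%Z by [].
  have em : ((n + n)%N%:Z == 0 %[mod (n + n)%N%:Z])%Z by rewrite eqz_mod_dvd subr0 dvdzz.
  have n8 : (8 <= n + n)%N by lia.
  have kk : (k + k <= n + n)%N by lia.
  have [-> _] := slides_affine n8 k0 kk e0.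
  have [_] := slides_affine n8 k0 kk em.
  rewrite /= subn0 subn1 (_ : (n + n - (n + n).-1)%N = 1%N); last lia.
  move=> ->; have [_|_] := eqVneq k 1%N.
    by rewrite (_ : -1 = 1 - 2%:Z) // qext_iotaQ_sub; lia.
  have [_|_] := eqVneq k 2%N; last by rewrite qext_coordD.
  by rewrite (_ : 0 = 1 - 1%:Z) // qext_iotaQ_sub; lia.
have [_|ni] := eqVneq i n.
  have [-> E] := slides_spin n4 hk; move: E.
  rewrite /= addnK (_ : (n + n - n.-1)%N = n.+1) 1?(_ : (n + n - n.+1)%N = n.-1); try lia.
  move=> ->; have [_|_] := eqVneq k n.-1.
    by rewrite (_ : n.+1 = n + n - n.-1)%N ?qext_iotaQ_add; lia.
  have [_|_] := eqVneq k n; last by rewrite qext_coordD.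
  by rewrite (_ : n.+2 = n + n - n.-1.-1)%N ?qext_iotaQ_add; lia.
have hi' : (0 < i < n)%N by lia.
have [-> E] := slides_swap hi' hk; move: E.
rewrite /= subKn; last lia.
move=> ->; have [_|_] := eqVneq k i; first by rewrite qext_coordD; lia.
by have [_|_] := eqVneq k i.+1; rewrite qext_coordD //; lia.
Qed.

(** * Self-conjugate cores with an even diagonal *)

Lemma iotaQ_inj n : injective (@iotaQ n).
Proof. by move=> x y /eq_row_mx[]. Qed.

Lemma lambda_iotaQP n (x : 'rV[int]_n) : (0 < n)%N ->
  [/\ is_part (lambda (iotaQ x)), is_core (n + n) (lambda (iotaQ x))
    & maya (lambda (iotaQ x)) =1 bullet (iotaQ x)].
Proof.
move=> n0; have m0 : (0 < n + n)%N by lia.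
have [h1 _ h2] := lambda_bullets m0 (iotaQ_corootA x).
by split=> //; apply: lambda_core => //; apply: iotaQ_corootA.
Qed.

Lemma sD_core_lambda n i (x : 'rV[int]_n) : (4 <= n)%N -> (i <= n)%N ->
  sD_core n i (lambda (iotaQ x)) = lambda (iotaQ (sD i x)).
Proof.
move=> n4 hi; have n0 : (0 < n)%N by lia.
have m0 : (0 < n + n)%N by lia.
have m1 : (1 < n + n)%N by lia.
have [h1 h2 h3] := lambda_iotaQP x n0.
have [h1' _ h3'] := lambda_iotaQP (sD i x) n0.
have [h4 h5] := maya_sA_word (sD_word n i) m1 h1 ((core_maya h1 m0).1 h2).
rewrite sD_coreE; apply: maya_inj => // p.
by rewrite h5 h3 h3' !bullet_qext // qext_sD.
Qed.

Lemma conjp_lambda_iotaQ n (x : 'rV[int]_n) : (0 < n)%N ->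
  conjp (lambda (iotaQ x)) = lambda (iotaQ x).
Proof.
move=> n0; have [h1 _ h3] := lambda_iotaQP x n0.
apply: maya_inj => //; first exact: conjp_part.
move=> p; rewrite maya_conjp // !h3 !bullet_qext; try lia.
by rewrite qext_iotaQ_rev //; lia.
Qed.

(** Self-conjugacy of the word says that the levels of opposite residue classes
    are opposite. *)
Lemma selfconj_core_iotaQ n la : (0 < n)%N -> is_core (n + n) la -> conjp la = la ->
  exists x : 'rV[int]_n, lambda (iotaQ x) = la.
Proof.
move=> n0 hc hconj; have m0 : (0 < n + n)%N by lia.
have hla : is_part la by case/andP: hc.
have [q hq Eq] := core_lambda m0 hc; have [_ _ hm] := lambda_bullets m0 hq.
exists (lsubmx q); rewrite antisym_iotaQ // => j.
have h k : (k < q 0 j) = ~~ (- k - 1 < q 0 (rev_ord j)).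
  by rewrite -!bulletE -position_rev -!hm Eq -maya_conjp // hconj.
have := h (q 0 j); have := h (q 0 j - 1); lia.
Qed.

(** A coordinate [x_j] and its opposite contribute [`|x_j|] positive bullets. *)
Lemma even_ndiag n (x : 'rV[int]_n) : (0 < n)%N ->
  ~~ odd (ndiag (lambda (iotaQ x))) = (2%:Z %| \sum_j x 0 j)%Z.
Proof.
move=> n0; have m0 : (0 < n + n)%N by lia.
have := ndiag_lambda m0 (iotaQ_corootA x).
rewrite big_split_ord /= [X in _ + X](reindex_inj rev_ord_inj) /= -big_split /=.
rewrite (eq_bigr (fun j => `|x 0 j|)) => [E|j _]; last first.
  by rewrite /iotaQ row_mxEl row_mxEr mxE rev_ordK; case: ifP; case: ifP; lia.
have -> : ~~ odd (ndiag (lambda (iotaQ x))) = (2%:Z %| (ndiag (lambda (iotaQ x)))%:Z)%Z.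
  by rewrite dvdzE /= dvdn2.
rewrite E -[in LHS](subrK (\sum_j x 0 j) (\sum_j _)) -sumrB.
rewrite rpredDl // rpred_sum // => j _; apply/dvdzP.
by case: (lerP 0 (x 0 j)) => h; [exists 0 | exists (- x 0 j)]; lia.
Qed.

(** Every self-conjugate core comes from an integer vector, and the parity of the
    diagonal selects the coroot lattice. *)
Lemma even_sc_coresP n la : (0 < n)%N ->
  even_sc_cores n la <-> exists2 x : 'rV[int]_n, corootD x & lambda (iotaQ x) = la.
Proof.
move=> n0; split=> [/and3P[hc /eqP hconj hd]|[x hx <-]].
  have [x Ex] := selfconj_core_iotaQ n0 hc hconj; exists x => //.
  by rewrite /corootD /= -even_ndiag // Ex.
have [_ hc _] := lambda_iotaQP x n0.
by apply/and3P; split=> //; rewrite ?even_ndiag // conjp_lambda_iotaQ.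
Qed.

Lemma lambda_iotaQ_inj n : (0 < n)%N -> injective (fun x : 'rV[int]_n => lambda (iotaQ x)).
Proof.
move=> n0 x y E; apply: iotaQ_inj; have m0 : (0 < n + n)%N by lia.
apply: bullet_inj => // p.
have [_ _ <-] := lambda_iotaQP x n0; have [_ _ <-] := lambda_iotaQP y n0.
by rewrite E.
Qed.

(** * Words in the generators *)

Lemma corootD_change2 n (x y : 'rV[int]_n) (a b : 'I_n) : a != b ->
  (forall j, j != a -> j != b -> y 0 j = x 0 j) ->
  (2%:Z %| (y 0 a + y 0 b - (x 0 a + x 0 b))%R)%Z -> corootD x -> corootD y.
Proof.
move=> ab xy h2; rewrite /corootD /= => hx.
have E (z : 'rV[int]_n) : \sum_j z 0 j =
    z 0 a + z 0 b + \sum_(j | (j != a) && (j != b)) z 0 j.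
  by rewrite (bigD1 a) //= (bigD1 b) ?[b == a]eq_sym //= addrA.
move: hx; rewrite !E (eq_bigr (fun j => y 0 j)) => [hx|j /andP[ja jb]]; last first.
  by rewrite xy.
rewrite (_ : y 0 a + y 0 b + _ = y 0 a + y 0 b - (x 0 a + x 0 b) +
  (x 0 a + x 0 b + \sum_(j | (j != a) && (j != b)) y 0 j)); last by ring.
exact: rpredD.
Qed.

Lemma sD_corootD n i (x : 'rV[int]_n) : (4 <= n)%N -> (i <= n)%N ->
  corootD x -> corootD (sD i x).
Proof.
move=> n4 hi.
have coordE (y : 'rV[int]_n) (j : 'I_n) : y 0 j = coordD y j.+1.
  by rewrite /coordD (big_pred1 j).
(* Each generator changes at most two coordinates and keeps the parity of their
   sum. *)
have change a b c : (0 < a <= n)%N -> (0 < b <= n)%N -> a != b ->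
    (forall k, k != a -> k != b -> (0 < k <= n)%N -> coordD (sD i x) k = coordD x k) ->
    coordD (sD i x) a + coordD (sD i x) b - (coordD x a + coordD x b) = c * 2%:Z ->
    corootD x -> corootD (sD i x).
  move=> ha hb ab h1 h2.
  have ha' : (a.-1 < n)%N by lia.
  have hb' : (b.-1 < n)%N by lia.
  apply: (@corootD_change2 _ _ _ (Ordinal ha') (Ordinal hb')).
  - by rewrite -val_eqE /=; lia.
  - move=> j ja jb; rewrite !coordE h1 ?ltn_ord //.
      by apply: contra ja => /eqP E; apply/eqP/val_inj; rewrite /= -E.
    by apply: contra jb => /eqP E; apply/eqP/val_inj; rewrite /= -E.
  by rewrite !coordE !prednK; try lia; rewrite h2 dvdz_mull.
have [i0|i0] := eqVneq i 0%N.
  apply: (change 1%N 2%N (1 - coordD x 1 - coordD x 2)) => //; try lia.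
    by move=> k /negbTE k1 /negbTE k2 hk; rewrite coordD_of // i0 /= k1 k2.
  by rewrite !coordD_of; try lia; rewrite i0 /=; ring.
have [ni|ni] := eqVneq i n.
  apply: (change n.-1 n (- coordD x n.-1 - coordD x n)); try lia.
    by move=> k /negbTE k1 /negbTE k2 hk; rewrite coordD_of // (negbTE i0) ni eqxx k1 k2.
  rewrite !coordD_of; try lia; rewrite (negbTE i0) ni !eqxx.
  by rewrite (_ : (n == n.-1) = false); [ring | lia].
apply: (change i i.+1 0); try lia.
  by move=> k /negbTE k1 /negbTE k2 hk; rewrite coordD_of // (negbTE i0) (negbTE ni) k1 k2.
rewrite !coordD_of; try lia; rewrite (negbTE i0) (negbTE ni) !eqxx.
by rewrite (_ : (i.+1 == i) = false); [ring | lia].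
Qed.

Lemma word_act_lambda n (w : seq 'I_n.+1) (x : 'rV[int]_n) : (4 <= n)%N ->
  word_act (@sD_core n) w (lambda (iotaQ x)) = lambda (iotaQ (word_act (@sD n) w x)).
Proof.
move=> n4; elim: w => //= i w ->; rewrite sD_core_lambda // -ltnS; exact: ltn_ord.
Qed.

Lemma word_act_corootD n (w : seq 'I_n.+1) (x : 'rV[int]_n) : (4 <= n)%N ->
  corootD x -> corootD (word_act (@sD n) w x).
Proof.
move=> n4 hx; elim: w => //= i w IH; apply: sD_corootD => //; rewrite -ltnS; exact: ltn_ord.
Qed.

(** * Sizes in type D *)

Definition sqnorm n (x : 'rV[int]_n) : rat := \sum_j (x 0 j)%:~R ^+ 2.
Definition psum n (x : 'rV[int]_n) (i : nat) : rat := \sum_(j < n | (j < i)%N) (x 0 j)%:~R.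

Lemma psum_iotaQ n (x : 'rV[int]_n) i : (i <= n)%N ->
  psum (iotaQ x) i = psum x i.
Proof.
move=> hi; rewrite /psum big_split_ord /= [X in _ + X]big1 ?addr0 => [|j]; last lia.
by apply: eq_bigr => j _; rewrite /iotaQ row_mxEl.
Qed.

(** The coordinates beyond the first [n] cancel those of index at least [i]. *)
Lemma psum_iotaQ_rev n (x : 'rV[int]_n) i : (i <= n)%N ->
  psum (iotaQ x) (n + n - i) = psum x i.
Proof.
move=> hi; rewrite /psum big_split_ord /= [X in _ + X](reindex_inj rev_ord_inj) /=.
rewrite (eq_bigl xpredT) => [|j]; last by have := ltn_ord j; lia.
rewrite (bigID (fun j : 'I_n => (j < i)%N)) /= -addrA.
rewrite [X in X + _](eq_bigr (fun j => (x 0 j)%:~R)) => [|j _]; last by rewrite /iotaQ row_mxEl.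
rewrite -[RHS]addr0; congr (_ + _).
rewrite (eq_bigr (fun j => (x 0 j)%:~R)) => [|j _]; last by rewrite /iotaQ row_mxEl.
rewrite [X in _ + X](eq_bigr (fun j => - (x 0 j)%:~R)) => [|j _]; last first.
  by rewrite /iotaQ row_mxEr mxE rev_ordK rmorphN.
rewrite sumrN (eq_bigl (fun j : 'I_n => (n + (n - j.+1) < n + n - i)%N)) ?subrr // => j.
by have := ltn_ord j; lia.
Qed.

Lemma size_res_lambdaQ m i (q : 'rV[int]_m) : (i < m)%N -> corootA q ->
  (psize_res m i (lambda q))%:R = 2^-1 * sqnorm q - psum q i.
Proof.
move=> im hq; have m0 : (0 < m)%N by lia.
have /(congr1 (fun z : int => z%:~R : rat)) := size_res_lambda m0 im hq.
rewrite rmorphB !rmorphM /= !rmorph_sum /= -/(psum q i).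
rewrite (eq_bigr (fun j => (q 0 j)%:~R ^+ 2)) => [|j _]; last by rewrite rmorphXn.
rewrite -/(sqnorm q) !pmulrn; lra.
Qed.

Lemma sqnorm_iotaQ n (x : 'rV[int]_n) : sqnorm (iotaQ x) = 2 * sqnorm x.
Proof.
rewrite /sqnorm big_split_ord /= [X in _ + X](reindex_inj rev_ord_inj) /=.
rewrite mulr_natl mulr2n; congr (_ + _); apply: eq_bigr => j _.
  by rewrite /iotaQ row_mxEl.
by rewrite /iotaQ row_mxEr mxE rev_ordK rmorphN sqrrN.
Qed.

Lemma dot_sum_std_vec n (x : 'rV[int]_n) i :
  dot (\sum_(1 <= k < i.+1) std_vec n k) (map_mx intr x) = psum x i.
Proof.
rewrite /dot /psum [RHS]big_mkcond; apply: eq_bigr => j _.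
rewrite summxE mxE; under eq_bigr do rewrite mxE.
have -> : \sum_(1 <= k < i.+1) (j.+1 == k)%:R = (j < i)%N%:R :> rat.
  elim: i => [|i IH]; first by rewrite big_geq.
  by rewrite big_nat_recr //= IH -natrD; congr _%:R; lia.
by case: ifP => _; rewrite ?mul1r ?mul0r.
Qed.

(** Up to [n - 2] the fundamental coweights are the partial sums; the two spin
    coweights are obtained from them by subtracting half of the full sum. *)
Lemma dot_coweight n (x : 'rV[int]_n) i : (4 <= n)%N -> (i <= n)%N ->
  dot (coweight n i) (map_mx intr x) =
  psum x i - (if (n.-1 <= i)%N then 2^-1 * psum x n else 0).
Proof.
move=> n4 hi.
have dotZl (a : rat) (u w : 'rV[rat]_n) : dot (a *: u) w = a * dot u w.
  by rewrite /dot mulr_sumr; apply: eq_bigr => j _; rewrite mxE mulrA.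
rewrite /coweight; have [->|i0] := eqVneq i 0%N.
  rewrite /psum big1 => [|j]; last by [].
  rewrite ifF; last lia.
  by rewrite subr0 /dot big1 // => j _; rewrite mxE mul0r.
case: leqP => hi2.
  by rewrite dot_sum_std_vec ifF ?subr0 //; lia.
have hn : n.-1.+1 = n by lia.
have -> : (n.-1 <= i)%N by lia.
have Es : dot (\sum_(1 <= k < n) std_vec n k) (map_mx intr x) = psum x n.-1.
  by rewrite -dot_sum_std_vec hn.
have En : psum x n = psum x n.-1 + dot (std_vec n n) (map_mx intr x).
  by rewrite -Es -dot_sum_std_vec big_nat_recr ?dotDl //; lia.
have [->|ni] := eqVneq i n.-1.
  rewrite dotZl dotDl dotNl Es En; lra.
have -> : i = n by lia.
rewrite dotZl dot_sum_std_vec; lra.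
Qed.

Lemma sizeD_resE n (x : 'rV[int]_n) i : (4 <= n)%N -> (i <= n)%N ->
  sizeD_res i x = (mark n i)%:R / 2 * sqnorm x - psum x i
    + (if (n.-1 <= i)%N then 2^-1 * psum x n else 0).
Proof.
move=> n4 hi; rewrite /sizeD_res dotDl dotNl dot_coweight //.
have -> : dot ((mark n i)%:R / 2 *: map_mx intr x) (map_mx intr x) =
    (mark n i)%:R / 2 * sqnorm x.
  rewrite /dot /sqnorm mulr_sumr; apply: eq_bigr => j _.
  by rewrite !mxE mulrA.
ring.
Qed.

Lemma size_res_iotaQ n (x : 'rV[int]_n) i : (0 < n)%N -> (i <= n)%N ->
  (psize_res (n + n) i (lambda (iotaQ x)))%:R = sqnorm x - psum x i.
Proof.
move=> n0 hi; rewrite size_res_lambdaQ; [|lia|exact: iotaQ_corootA].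
by rewrite psum_iotaQ // sqnorm_iotaQ mulKf.
Qed.

Lemma size_res_iotaQ_rev n (x : 'rV[int]_n) i : (0 < i <= n)%N ->
  (psize_res (n + n) (n + n - i) (lambda (iotaQ x)))%:R = sqnorm x - psum x i.
Proof.
move=> /andP[i0 hi].
rewrite size_res_lambdaQ; [|lia|exact: iotaQ_corootA].
by rewrite psum_iotaQ_rev // sqnorm_iotaQ mulKf.
Qed.

Lemma psum0 n (x : 'rV[int]_n) : psum x 0 = 0.
Proof. by rewrite /psum big1. Qed.

Lemma sizeD_res_size n (x : 'rV[int]_n) i : (4 <= n)%N -> (i <= n)%N ->
  let sz k : rat := (psize_res (n + n) k (lambda (iotaQ x)))%:R in
  sizeD_res i x =
    2^-1 * (if (1 < i < n.-1)%N then sz i + sz (n + n - i)%N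
            else if i == n.-1 then sz n.-1 + sz n.+1 - sz n
            else if i == 1%N then sz 1%N + sz (n + n).-1 - sz 0%N
            else sz i).
Proof.
move=> n4 hi sz; rewrite sizeD_resE // /mark.
have szE k : (k <= n)%N -> sz k = sqnorm x - psum x k.
  by move=> hk; apply: size_res_iotaQ => //; lia.
have szE' k : (0 < k <= n)%N -> sz (n + n - k)%N = sqnorm x - psum x k.
  exact: size_res_iotaQ_rev.
have sz0 := szE 0%N isT; rewrite psum0 in sz0.
have [i0|ni0] := eqVneq i 0%N.
  have -> : (n.-1 <= i)%N = false by lia.
  have -> : (i == n.-1) = false by lia.
  rewrite i0 /= sz0 psum0; lra.
have [i1|ni1] := eqVneq i 1%N.
  have -> : (n.-1 <= i)%N = false by lia.
  have -> : (i == n.-1) = false by lia.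
  rewrite i1 /= sz0 szE -?subn1 ?szE'; try lia; lra.
have [En|nin] := eqVneq i n.
  have -> : (n.-1 <= i)%N by lia.
  have -> : (i == n.-1) = false by lia.
  have -> : (1 < i <= n - 2)%N = false by lia.
  have -> : (1 < i < n.-1)%N = false by lia.
  rewrite szE // En; lra.
have [En|nin1] := eqVneq i n.-1.
  rewrite En leqnn.
  have -> : (1 < n.-1 <= n - 2)%N = false by lia.
  have -> : (1 < n.-1 < n.-1)%N = false by lia.
  have -> : n.+1 = (n + n - n.-1)%N by lia.
  rewrite szE' ?szE; try lia; lra.
have -> : (n.-1 <= i)%N = false by lia.
have -> : (1 < i <= n - 2)%N by lia.
have -> : (1 < i < n.-1)%N by lia.
rewrite szE ?szE'; try lia; lra.
Qed.

(** The terms [size_(2 n - i)] with [0 < i < n] supply the residues larger than [n],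
    and the correction terms of [i = 1] and [i = n - 1] remain. *)
Lemma sizeD_size n (x : 'rV[int]_n) : (4 <= n)%N ->
  let sz k : rat := (psize_res (n + n) k (lambda (iotaQ x)))%:R in
  sizeD x = 2^-1 * ((psize (lambda (iotaQ x)))%:R - sz 0%N - sz n).
Proof.
move=> n4 sz.
(* At [i = 0] and [i = n] there is no second term, at [i = 1] and [i = n - 1] it
   comes with a correction. *)
pose B i := (if (0 < i < n)%N then sz (n + n - i)%N else 0).
have -> : sizeD x = \sum_(i < n.+1) 2^-1 *
    (sz i + B i - (i == 1 :> nat)%:R * sz 0%N - (i == n.-1 :> nat)%:R * sz n).
  apply: eq_bigr => i _; have hi : (i <= n)%N by rewrite -ltnS; exact: ltn_ord.
  rewrite sizeD_res_size // -/sz /B; move: (nat_of_ord i) hi => {}i hi.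
  have [i0|ni0] := eqVneq i 0%N.
    have -> : (i == n.-1) = false by lia.
    rewrite i0 /=; lra.
  have [i1|ni1] := eqVneq i 1%N.
    have -> : (i == n.-1) = false by lia.
    have -> : (0 < i < n)%N by lia.
    rewrite i1 /= subn1; lra.
  have [En|nin1] := eqVneq i n.-1.
    have -> : (1 < i < n.-1)%N = false by lia.
    have -> : (0 < i < n)%N by lia.
    have -> : (n + n - i = n.+1)%N by lia.
    rewrite En /=; lra.
  have [En|nin] := eqVneq i n.
    rewrite En ltnn andbF.
    have -> : (1 < n < n.-1)%N = false by lia.
    rewrite /=; lra.
  have -> : (0 < i < n)%N by lia.
  have -> : (1 < i < n.-1)%N by lia.
  rewrite /=; lra.
rewrite -mulr_sumr; congr (_ * _); rewrite !sumrB big_split /=.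
have pick (k : nat) (z : rat) : (k <= n)%N -> \sum_(i < n.+1) (i == k :> nat)%:R * z = z.
  move=> hk; have hk' : (k < n.+1)%N by [].
  rewrite (bigD1 (Ordinal hk')) //= eqxx mul1r big1 ?addr0 // => i.
  by rewrite -val_eqE /= => /negbTE ->; rewrite mul0r.
rewrite !pick; [|lia..]; congr (_ - _ - _).
have m0 : (0 < n + n)%N by lia.
rewrite -(sum_psize_res (lambda (iotaQ x)) m0) natr_sum.
rewrite -(big_mkord xpredT (fun i => sz i)) -(big_mkord xpredT B).
rewrite -(big_mkord xpredT (fun i => sz i)).
have hn : (n.+1 <= n + n)%N by lia.
rewrite (@big_cat_nat _ _ _ n.+1 0 (n + n)) //=; congr (_ + _).
rewrite big_nat_recr //= {2}/B ltnn andbF addr0 big_ltn; last lia.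
rewrite {1}/B /= add0r [RHS]big_nat_rev /= -{1}[n.+1]add1n [RHS]big_addn addnK.
apply: eq_big_nat => i hi; rewrite /B hi; congr sz; lia.
Qed.

Theorem theorem5p4 (n : nat) (hn : (4 <= n)%N) :
  [/\ WD_acts n (@corootD n) (@sD n),
      WD_acts n (@even_sc_cores n) (@sD_core n),
      set_bij (@corootD n) (@even_sc_cores n) (fun x => lambda (iotaQ x)),
      WD_equivariant n (@corootD n) (@sD n) (@sD_core n)
        (fun x => lambda (iotaQ x))
    & forall x : 'rV[int]_n, corootD x ->
      let la := lambda (iotaQ x) in
      let sz i : rat := (psize_res (n + n) i la)%:R in
      (forall i : nat, (i <= n)%N ->
         sizeD_res i x =
           2^-1 * (if (1 < i < n.-1)%N then sz i + sz (n + n - i)%N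
                   else if i == n.-1 then sz n.-1 + sz n.+1 - sz n
                   else if i == 1%N then sz 1%N + sz (n + n).-1 - sz 0%N
                   else sz i)) /\
      sizeD x = 2^-1 * ((psize la)%:R - sz 0%N - sz n)].
Proof.
have n0 : (0 < n)%N by lia.
split.
- by split=> [w x|w w' ww' x _]; [exact: word_act_corootD | exact: ww'].
- split=> [w la|w w' ww' la] /(even_sc_coresP _ n0)[x hx <-].
    rewrite word_act_lambda //; apply/(even_sc_coresP _ n0).
    by exists (word_act (@sD n) w x) => //; apply: word_act_corootD.
  by rewrite !word_act_lambda // ww'.
- split=> [x hx|x y _ _|la /(even_sc_coresP _ n0)[x hx <-]].
  + by apply/(even_sc_coresP _ n0); exists x.
  + exact: lambda_iotaQ_inj.
  + by exists x.
- by move=> w x _; rewrite word_act_lambda.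
move=> x _ la sz; split=> [i hi|]; [exact: sizeD_res_size | exact: sizeD_size].
Qed.
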